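(* Assume that the regularization functions $\alpha^{R,\delta},\beta^\delta$ satisfy assumptions (Reg) and (Reg-der) of the context and that the weight satisfies assumption (Reg-$\gamma$) of the context. Write $\check L^2_\delta=L^2_{\beta^\delta\gamma}(\Gamma^R)$ and $\check W^{1,2}_\delta=W^{1,2}_{\alpha^{R,\delta}\gamma,\beta^\delta\gamma}(\Gamma^R)$. Then for any fixed $R>H_0$ and $\delta\in(0,\delta_0)$ there exists $C=C(R,\delta)>0$, independent of $h$, such that $$\|\Pi_h\varphi-\varphi\|_{\check L^2_\delta}\le C(R,\delta)\,h\,\|\varphi\|_{\check W^{1,2}_\delta}\qquad\text{for all }\varphi\in\check W^{1,2}_\delta,$$ $$\|\Pi_h\varphi-\varphi\|_{\check W^{1,2}_\delta}\le C(R,\delta)\,h\,\big(\|\varphi\|_{\check W^{1,2}_\delta}+\|\check{\mathcal L}^\delta\varphi\|_{\check L^2_\delta}\big)\qquad\text{for all }\varphi\in D(\check{\mathcal L}^\delta).$$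
   Context: Graph. Let $H\in\mathcal C^4(\mathbb R^2;\mathbb R)$ have bounded second derivatives and $\min_{\mathbb R^2}H=0$; suppose $H$ has finitely many critical points $\mathbf x_1,\dots,\mathbf x_n$, all with nondegenerate Hessian and with pairwise distinct values $H(\mathbf x_i)$; and suppose there are $\mathfrak a_1,\mathfrak a_2,\mathfrak a_3>0$ with $H(x)\ge \mathfrak a_1|x|^2$, $|\nabla H(x)|\ge \mathfrak a_2|x|$, $\Delta H(x)\ge \mathfrak a_3$ for all $|x|$ large. Identifying all points in the same connected component of a level set $\{H=z\}$ gives a connected metric graph $\Gamma$ (shortest-path distance) with vertices $O_1,\dots,O_n$ ($O_i$ corresponding to $\mathbf x_i$) and edges $I_1,\dots,I_m$. $O_i$ is an interior vertex (incident to three edges) if $\mathbf x_i$ is a saddle point, and an exterior vertex (incident to one edge) if $\mathbf x_i$ is a local extremum. A point of $\Gamma$ is written $(z,k)$, where $k$ is the edge index and $z$ the value of $H$. For $k\le m-1$, $I_k\cong[a_k,b_k]$ with $a_k<b_k$ the values of $H$ at its two end vertices; the only unbounded edge is $I_m\cong[H_0,\infty)$, $H_0=\max_iH(\mathbf x_i)$. Functions on $\Gamma$ are families of functions on the edges; $f$ is continuous at a vertex if its coordinate functions on all incident edges take the same value there. Coefficients. For $z$ in the interior of $I_k$ let $\mathrm C_k(z)$ be the corresponding connected component of $\{H=z\}$ and $\alpha_k(z)=\oint_{\mathrm C_k(z)}|\nabla H|\,\mathrm dl$, $\beta_k(z)=\oint_{\mathrm C_k(z)}|\nabla H|^{-1}\,\mathrm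 dl$ (values at endpoints are one-sided limits). Recalled facts: $\alpha_k,\beta_k$ are $\mathcal C^1$ in the interior of $I_k$ and, up to positive multiplicative constants, as $(z,k)\to O_i$: $\alpha_k(z)\sim|z-H(\mathbf x_i)|$, $\beta_k\sim1$ if $\mathbf x_i$ is a local extremum; $\alpha_k\sim1$, $\beta_k(z)\sim|\log|z-H(\mathbf x_i)||$ if $\mathbf x_i$ is a saddle; and $\alpha_m(z)\sim z$, $\beta_m\sim1$ as $z\to\infty$. Spaces. On a graph with edges $E_k$ and measurable weights $\sigma_k,\nu_k:E_k\to[0,\infty)$: $L^2_\nu=\bigoplus_k L^2(E_k;\nu_k\,\mathrm dz)$ (complex-valued), and $W^{1,2}_{\sigma,\nu}$ consists of $w\in L^2_\nu$ with weak derivative $w'\in L^2_\sigma$ on each edge, with norm $(\|w\|^2_{L^2_\nu}+\|w'\|_{L^2_\sigma}^2)^{1/2}$; $W^{1,2,c}_{\sigma,\nu}$ is the subspace of functions continuous at each interior vertex. Products of weights are taken edgewise. Weight. $\gamma:\Gamma\to(0,\infty)$, $(z,k)\mapsto\gamma_k(z)$, is continuous on $\Gamma$ and continuously differentiable on the interior of each edge. Truncation. For $R>H_0$, $\eta_R:\Gamma\to[0,1]$ is a continuous cut-off function depending only on $z$, with $\eta_R=1$ for $0\le z\le R$ and $\eta_R=0$ for $z\ge R+1$. $\Gamma^R:=\{(z,k)\in\Gamma:z\le R+1\}$ is a compact graph with edges $J_k=I_k$ ($k\le m-1$), $J_m\cong[H_0,R+1]$, and vertices $O_1,\dots,O_n$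 and the additional exterior vertex $O_{n+1}=(R+1,m)$; the $z$-coordinate of any vertex $O_i$ is also written $H(\mathbf x_i)$ (so it is $R+1$ for $i=n+1$). $\mathring J_k$ is the interior of $J_k$. $\alpha_k^R=\alpha_k\eta_R$. Regularization. Each $J_k$, $k\le m-1$, is split into two halves $J_k^{(1)},J_k^{(2)}$ of equal length, and $J_m$ into $J_m^{(1)}\cong[H_0,H_0+1]$ and $J_m^{(2)}\cong[H_0+1,R+1]$; each piece is incident to exactly one vertex. For $\delta$ in $(0,\delta_{\min})$, $\delta_{\min}=\frac14\min_k|J_k|$, one is given weights $\alpha_k^{R,\delta},\beta_k^\delta$ on $J_k$ with $\beta_k^\delta=\beta_k$ on every piece incident to an exterior vertex and $\alpha_k^{R,\delta}=\alpha^R_k$ on every piece incident to an interior vertex. (Reg): for some $\delta_0>0$ and all $\delta\in(0,\delta_0)$ there are positive constants $\mathfrak c_1(\delta),\mathfrak c_4(\delta)$ such that for all $(z,k)\in\mathring J_k$, $k=1,\dots,m$: $\max\{\mathfrak c_0\alpha_k^R(z),\mathfrak c_1(\delta)\}\le\alpha_k^{R,\delta}(z)\le\mathfrak c_2(\alpha_k(z)+1)$, $\lim_{\delta\to0}\alpha_k^{R,\delta}(z)=\alpha_k^R(z)$, $0<\mathfrak c_3\le\beta_k^\delta(z)\le\min\{\mathfrak c_4(\delta),\mathfrak c_5\beta_k(z)\}$, $\lim_{\delta\to0}\beta_k^\delta(z)=\beta_k(z)$, where $\mathfrak c_0,\mathfrak c_2,\mathfrak c_3,\mathfrak c_5$ are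 (positive) constants independent of $R$ and $\delta$. (Reg-$\gamma$): there is a constant $\kappa_1>0$ such that for any $\delta\in(0,\delta_0)$: $\alpha_k^{R,\delta}(z)|\gamma_k'(z)|^2\le\kappa_1\beta_k^\delta(z)|\gamma_k(z)|^2$ for $(z,k)\in\Gamma^R$. (Reg-der): for any fixed $R>H_0$, $\delta\in(0,\delta_0)$ and $k=1,\dots,m$, $\alpha_k^{R,\delta}$ is continuously differentiable on the edge $J_k$ and $(\alpha_k^{R,\delta})'\in L^4(J_k)$. Operator. $\check{\mathcal L}^\delta f=\frac1{2\beta_k^\delta}(\alpha_k^{R,\delta}f')'$ on $\mathring J_k$, with domain $D(\check{\mathcal L}^\delta)$ the set of $f\in W^{1,2,c}_{\alpha^{R,\delta}\gamma,\beta^\delta\gamma}(\Gamma^R)$ such that $\alpha_k^{R,\delta}f'$ is differentiable on each $J_k$, $\check{\mathcal L}^\delta f\in L^2_{\beta^\delta\gamma}(\Gamma^R)$ and $\sum_{k:J_k\sim O_i}\alpha^{R,\delta}_k(H(\mathbf x_i))\Phi_{k,i}f'(H(\mathbf x_i),k)=0$ at every vertex $O_i$ of $\Gamma^R$ (sum over incident edges; $\Phi_{k,i}=+1$ if $z$ decreases along the edge towards $O_i$, $-1$ if it increases). Interpolation. Each $J_k$ is uniformly subdivided into $n_k$ subintervals of length $h_k$; $h:=\min_{1\le k\le m}h_k$. $\mathbb V_h(\Gamma^R)$ is the span of the standard hat functions at all interior nodes of the subdivisions and at all vertices of $\Gamma^R$ (the vertex hat function of $O_i$ being $1-|z-H(\mathbf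 x_i)|/h_k$ on the part of each incident edge $J_k$ within distance $h_k$ of $O_i$, and zero elsewhere); restricted to each edge, its elements are piecewise linear. $\Pi_h\varphi\in\mathbb V_h(\Gamma^R)$ denotes the Lagrange first-order interpolation of a function $\varphi$ on $\Gamma^R$ in the nodes and the vertices.
   Formalization: The bound C h with h = min h_k fails when the h_k are not comparable; it is proved as C κ h whenever h_k ≤ κ h for all k (C independent of κ and of the mesh), and Π_h of a φ discontinuous at a vertex is taken edge by edge. *)

(* Defs.v *)
From HB Require Import structures.
From mathcomp Require Import all_boot all_order all_algebra.
From mathcomp Require Import all_classical all_reals all_analysis.
From mathcomp.real_closed Require Import complex.

Set Implicit Arguments.
Unset Strict Implicit.
Unset Printing Implicit Defensive.

Import Order.TTheory GRing.Theory Num.Theory.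
Import numFieldNormedType.Exports.

Local Open Scope classical_set_scope.
Local Open Scope ring_scope.
Local Open Scope complex_scope.

Section Plane.
Variable R : realType.
Implicit Types (f : 'rV[R]_2 -> R) (p : 'rV[R]_2).

Definition basis_vec (i : 'I_2) : 'rV[R]_2 := delta_mx 0 i.

(* The library norm of 'rV[R]_2 is the sup norm; this is the Euclidean one. *)
Definition enorm p : R := Num.sqrt (\sum_(i < 2) p 0 i ^+ 2).

Definition grad f p : 'rV[R]_2 := \row_i 'D_(basis_vec i) f p.

Definition hessian f p : 'M[R]_2 :=
  \matrix_(i, j) 'D_(basis_vec i) (fun q => 'D_(basis_vec j) f q) p.

Definition laplacian f p : R := \tr (hessian f p).

Fixpoint class_C (j : nat) f : Prop :=
  if j is j'.+1 then
    (forall i p, derivable f p (basis_vec i)) /\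
    (forall i, class_C j' (fun p => 'D_(basis_vec i) f p))
  else continuous f.

Definition local_extremum f p : Prop :=
  (\forall q \near p, f p <= f q) \/ (\forall q \near p, f q <= f p).

(* 1-periodic regular C^1 parametrization of the simple closed curve [c]. *)
Definition closed_param (c : set 'rV[R]_2) (theta : R -> 'rV[R]_2) : Prop :=
  [/\ forall t, derivable theta t 1 /\ 'D_1 theta t != 0,
      continuous (fun t => 'D_1 theta t),
      forall t, theta (t + 1) = theta t,
      {in `[0, 1[ &, injective theta}
    & theta @` `[0, 1[ = c].

(* The value does not depend on the parametrization; it is 0 by convention when
   [c] is not a regular simple closed curve. *)
Definition line_integral (c : set 'rV[R]_2) f : R :=
  xget 0 [set v | exists2 theta, closed_param c theta &
    v = \int[@lebesgue_measure R]_(t in `[0, 1])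
          (f (theta t) * enorm ('D_1 theta t))].

End Plane.


(* [ge.+1] edges, of which [ord_max] is the unbounded one; [edge k] is the
   region of the plane swept by the level-set components which are the interior
   points of the k-th edge; [lo k] and [up k] are the end vertices of the edge
   with smaller and larger value of H ([None] on the unbounded edge). *)
Record hgraph (R : realType) := HGraph {
  ham : 'rV[R]_2 -> R;
  gv : nat;
  crit : 'I_gv -> 'rV[R]_2;
  ge : nat;
  edge : 'I_ge.+1 -> set 'rV[R]_2;
  lo : 'I_ge.+1 -> 'I_gv;
  up : 'I_ge.+1 -> option 'I_gv }.

Section Graph.
Variables (R : realType) (G : hgraph R).
Local Notation H := (ham G).
Local Notation E := ('I_(ge G).+1).
(* Vertices of the truncated graph; [None] is the additional vertex (R+1, m). *)
Local Notation V := (option 'I_(gv G)).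
Implicit Types (k : E) (v : V) (i : 'I_(gv G)) (r z : R).

Definition admissible_hamiltonian : Prop :=
  [/\ class_C 4 H,
      exists M : R, forall p (i j : 'I_2), `|hessian H p i j| <= M,
      (forall p, 0 <= H p) /\ (exists p, H p = 0),
      [/\ injective (@crit R G),
          range (@crit R G) = [set p | grad H p = 0],
          forall i, \det (hessian H (crit i)) != 0
        & injective (fun i => H (crit i))]
    & exists a1 a2 a3 rho : R,
      [/\ 0 < a1, 0 < a2, 0 < a3 &
        forall p, rho <= enorm p ->
          [/\ a1 * enorm p ^+ 2 <= H p,
              a2 * enorm p <= enorm (grad H p)
            & a3 <= laplacian H p]]].

Definition H0 : R := \big[Num.max/0]_(i : 'I_(gv G)) H (crit i).

Definition level z : set 'rV[R]_2 := [set p | H p = z].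

(* The level-set component through a critical point, i.e. a vertex. *)
Definition crit_comp i : set 'rV[R]_2 :=
  connected_component (level (H (crit i))) (crit i).

Definition regular_part : set 'rV[R]_2 := ~` \bigcup_i crit_comp i.

Definition ja k : R := H (crit (lo k)).

Definition I_int k : interval R :=
  Interval (BRight (ja k))
    (if up k is Some i then BLeft (H (crit i)) else +oo%O).
Definition I_cl k : interval R :=
  Interval (BLeft (ja k))
    (if up k is Some i then BRight (H (crit i)) else +oo%O).

Definition incident k v : bool := (Some (lo k) == v) || (up k == v).

Definition degree v : nat := #|[set k | incident k v]%SET|.

(* Removing the vertices from the quotient of the plane by level-set components
   leaves the open edges; as level-set components are connected, open edges
   correspond to connected components of [regular_part]. Since critical values
   are distinct, an end vertex is determined by its value of H. *)
Definition is_level_graph : Prop :=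
  [/\ forall k, exists2 p, regular_part p &
        edge k = connected_component regular_part p,
      forall p, regular_part p -> exists! k, edge k p,
      forall k p, edge k p ->
        edge k `&` level (H p) = connected_component (level (H p)) p,
      forall k, H @` edge k = [set` I_int k]
    & [/\ forall k, (up k == None) = (k == ord_max),
          ja ord_max = H0,
          forall i, local_extremum H (crit i) -> degree (Some i) = 1%N
        & forall i, ~ local_extremum H (crit i) -> degree (Some i) = 3%N]].

Definition level_comp k z : set 'rV[R]_2 := edge k `&` level z.

Definition alpha k z : R :=
  line_integral (level_comp k z) (fun p => enorm (grad H p)).
Definition beta k z : R :=
  line_integral (level_comp k z) (fun p => (enorm (grad H p))^-1).

Definition interior_vertex v : Prop :=
  if v is Some i then ~ local_extremum H (crit i) else False.

Definition admissible_weight (gam : E -> R -> R) : Prop :=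
  [/\ forall k z, z \in I_cl k -> 0 < gam k z,
      forall k, {within [set` I_cl k], continuous (gam k)},
      forall i k l, incident k (Some i) -> incident l (Some i) ->
        gam k (H (crit i)) = gam l (H (crit i)),
      forall k, {in I_int k, forall z, derivable (gam k) z 1}
    & forall k, {in I_int k, continuous (derive1 (gam k))}].


Definition vcoord r v : R := if v is Some i then H (crit i) else r + 1.
Definition jb r k : R := vcoord r (up k).

Definition J r k : interval R := `[ja k, jb r k].
Definition Jint r k : interval R := `]ja k, jb r k[.
Definition Jlen r k : R := jb r k - ja k.

Definition min_edges (F : E -> R) : R := \big[Num.min/F ord_max]_k F k.

Definition delta_min r : R := 4^-1 * min_edges (Jlen r).

Definition cutoff (eta : R -> R -> R) : Prop := forall r, H0 < r ->
  [/\ {within `[0, +oo[, continuous (eta r)},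
      forall z, 0 <= z -> 0 <= eta r z <= 1,
      forall z, 0 <= z <= r -> eta r z = 1
    & forall z, r + 1 <= z -> eta r z = 0].

Definition split_point r k : R :=
  if k == ord_max then ja k + 1 else (ja k + jb r k) / 2.

Variables (eta : R -> R -> R).
(* [alr r d k] is alpha_k^{R,delta}, [ber d k] is beta_k^delta. *)
Variables (alr : R -> R -> E -> R -> R) (ber : R -> E -> R -> R).

(* Stated at interior points only: [beta] may tend to infinity at an end point,
   and end points are negligible for integrals; the end values of [alr] are
   fixed by continuity in [Reg_der]. *)
Definition regularizing_weights : Prop :=
  forall r d, H0 < r -> 0 < d < delta_min r -> forall k,
  [/\ measurable_fun [set` J r k] (alr r d k),
      measurable_fun [set` J r k] (ber d k)
    & forall z, z \in Jint r k ->
      forall v, (v = Some (lo k) /\ z <= split_point r k) \/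
                (v = up k /\ split_point r k <= z) ->
        (~ interior_vertex v -> ber d k z = beta k z) /\
        (interior_vertex v -> alr r d k z = alpha k z * eta r z)].

Definition Reg (delta0 : R) : Prop :=
  exists c0 c2 c3 c5 : R, [/\ 0 < c0, 0 < c2, 0 < c3 & 0 < c5] /\
  forall r, H0 < r ->
    (forall d, 0 < d < delta0 -> exists c1 c4 : R, [/\ 0 < c1, 0 < c4 &
       forall k z, z \in Jint r k ->
         (Num.max (c0 * (alpha k z * eta r z)) c1 <= alr r d k z
            <= c2 * (alpha k z + 1)) /\
         (c3 <= ber d k z <= Num.min c4 (c5 * beta k z))]) /\
    (forall k z, z \in Jint r k ->
       (alr r d k z @[d --> 0^'+] --> alpha k z * eta r z) /\
       (ber d k z @[d --> 0^'+] --> beta k z)).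

Definition Reg_gamma (delta0 : R) (gam : E -> R -> R) : Prop :=
  forall r, H0 < r -> exists2 kappa1 : R, 0 < kappa1 &
  forall d, 0 < d < delta0 -> forall k z, z \in Jint r k ->
    alr r d k z * `|derive1 (gam k) z| ^+ 2 <= kappa1 * ber d k z * `|gam k z| ^+ 2.

(* C^1 inside the edge and continuous up to the end points: near an interior
   vertex alr agrees with alpha * eta, whose derivative may blow up there. *)
Definition Reg_der (delta0 : R) : Prop :=
  forall r d, H0 < r -> 0 < d < delta0 -> forall k,
  [/\ {within [set` J r k], continuous (alr r d k)},
      {in Jint r k, forall z, derivable (alr r d k) z 1},
      {in Jint r k, continuous (derive1 (alr r d k))}
    & (\int[@lebesgue_measure R]_(z in [set` Jint r k])
        (`|derive1 (alr r d k) z| ^+ 4)%:E < +oo)%E].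

End Graph.

Section WeakDerivative.
Variable R : realType.
Local Notation mu := (@lebesgue_measure R).

(* Testing against C^1 rather than smooth functions with compact support gives
   the same notion. *)
Definition real_weak_derivative (a b : R) (u g : R -> R) : Prop :=
  (forall c d, a < c -> d < b ->
     mu.-integrable `[c, d] (EFin \o u) /\
     mu.-integrable `[c, d] (EFin \o g)) /\
  (forall (psi : R -> R) c d, a < c -> d < b ->
     (forall z, derivable psi z 1) -> continuous (derive1 psi) ->
     (forall z, z \notin `[c, d] -> psi z = 0) ->
     \int[mu]_(z in `]a, b[) (u z * derive1 psi z) =
       - \int[mu]_(z in `]a, b[) (g z * psi z)).

Definition weak_derivative (a b : R) (w g : R -> R[i]) : Prop :=
  real_weak_derivative a b (complex.Re (R:=R) \o w) (complex.Re (R:=R) \o g) /\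
  real_weak_derivative a b (complex.Im (R:=R) \o w) (complex.Im (R:=R) \o g).

(* A weak derivative, unique up to a null set when it exists. *)
Definition wderiv (a b : R) (w : R -> R[i]) : R -> R[i] :=
  xget (fun=> 0) [set g | weak_derivative a b w g].

Definition ccontinuous_on (I : interval R) (w : R -> R[i]) : Prop :=
  {within [set` I], continuous (fun z => complex.Re (w z))} /\
  {within [set` I], continuous (fun z => complex.Im (w z))}.

End WeakDerivative.

Section Spaces.
Variables (R : realType) (G : hgraph R) (r : R).
Local Notation H := (ham G).
Local Notation E := ('I_(ge G).+1).
Local Notation V := (option 'I_(gv G)).
Local Notation mu := (@lebesgue_measure R).
Implicit Types (k l : E) (v : V) (sigma nu : E -> R -> R) (w f : E -> R -> R[i]).

Definition gderiv w : E -> R -> R[i] :=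
  fun k => wderiv (ja k) (jb r k) (w k).

Definition wmul sigma w : E -> R -> R[i] := fun k z => (sigma k z)%:C * w k z.

Definition L2norm2 nu w : \bar R :=
  (\sum_k \int[mu]_(z in [set` J r k])
     ((complex.Re (w k z) ^+ 2 + complex.Im (w k z) ^+ 2) * nu k z)%:E)%E.

Definition L2norm nu w : \bar R := sqrte (L2norm2 nu w).

Definition W12norm sigma nu w : \bar R :=
  sqrte (L2norm2 nu w + L2norm2 sigma (gderiv w))%E.

Definition in_L2 nu w : Prop :=
  (forall k, measurable_fun [set` J r k] (fun z => complex.Re (w k z)) /\
             measurable_fun [set` J r k] (fun z => complex.Im (w k z))) /\
  (L2norm2 nu w < +oo)%E.

Definition in_W12 sigma nu w : Prop :=
  [/\ in_L2 nu w,
      forall k, exists g, weak_derivative (ja k) (jb r k) (w k) g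
    & in_L2 sigma (gderiv w)].

Definition edge_continuous w : Prop := forall k, ccontinuous_on (J r k) (w k).

Definition vertex_continuous v w : Prop :=
  forall k l, incident k v -> incident l v ->
    w k (vcoord r v) = w l (vcoord r v).

(* Members are taken with their representative continuous on each closed edge,
   as the condition involves values at vertices. *)
Definition in_W12c sigma nu w : Prop :=
  [/\ in_W12 sigma nu w, edge_continuous w
    & forall v, interior_vertex v -> vertex_continuous v w].

Definition Lop (al be : E -> R -> R) f : E -> R -> R[i] :=
  fun k z => ((2 * be k z)^-1)%:C * gderiv (wmul al (gderiv f)) k z.

Definition Phi k v : R := if Some (lo k) == v then 1 else -1.

(* The derivative at a vertex is the value of the representative of f' which is
   continuous up to the end points. *)
Definition kirchhoff (al : E -> R -> R) f : Prop :=
  exists g : E -> R -> R[i],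
  [/\ forall k, weak_derivative (ja k) (jb r k) (f k) (g k),
      edge_continuous g
    & forall v, \sum_(k | incident k v)
        (al k (vcoord r v) * Phi k v)%:C * g k (vcoord r v) = 0].

Definition in_dom (al be gam : E -> R -> R) f : Prop :=
  [/\ in_W12c (fun k z => al k z * gam k z) (fun k z => be k z * gam k z) f,
      forall k, exists g,
        weak_derivative (ja k) (jb r k) (wmul al (gderiv f) k) g,
      in_L2 (fun k z => be k z * gam k z) (Lop al be f)
    & kirchhoff al f].

Variable N : E -> nat.

Definition hk k : R := Jlen r k / (N k)%:R.
Definition mesh_min : R := min_edges (G := G) hk.

Definition node k (j : nat) : R := ja k + j%:R * hk k.

Definition hat (c s z : R) : R := Num.max 0 (1 - `|z - c| / s).

Definition node_hat l (j : nat) : E -> R -> R := fun k z =>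
  if k == l then hat (node l j) (hk l) z else 0.

Definition vertex_hat v : E -> R -> R := fun k z =>
  if incident k v then hat (vcoord r v) (hk k) z else 0.

Definition in_Vh w : Prop :=
  exists (c : E -> nat -> R[i]) (d : V -> R[i]), forall k z, z \in J r k ->
    w k z = \sum_l \sum_(1 <= j < N l) c l j * (node_hat l j k z)%:C
            + \sum_v d v * (vertex_hat v k z)%:C.

(* The value at a vertex is read off from the edge under consideration; see
   [interp_in_Vh] for the functions which are continuous at the vertices. *)
Definition interp w : E -> R -> R[i] := fun k z =>
  \sum_l \sum_(1 <= j < N l) w l (node l j) * (node_hat l j k z)%:C
  + \sum_v w k (vcoord r v) * (vertex_hat v k z)%:C.

Lemma interp_in_Vh w : (forall v, vertex_continuous v w) -> in_Vh (interp w).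
Proof.
move=> wc; exists (fun l j => w l (node l j)).
exists (fun v => if [pick k | incident k v] is Some k then w k (vcoord r v)
                 else 0) => k z _.
congr (_ + _); apply: eq_bigr => v _; rewrite /vertex_hat.
case: ifPn => [kv|_]; last by rewrite !mulr0.
by case: pickP => [l lv|/(_ k)]; rewrite ?kv//; congr (_ * _); exact: wc.
Qed.

End Spaces.

(* Main.v *)
(** On an edge the weights are bounded above and away from zero, for fixed R and
    delta, so both estimates reduce to unweighted estimates for real functions
    on an interval, applied to real and imaginary parts. On a mesh cell the
    oscillation of phi is at most h^(1/2) times the L^2 norm of phi' by
    Cauchy-Schwarz, which gives the first estimate. For the second one, the
    slope of the interpolant on a cell is the mean of phi', so the error is
    controlled by the oscillation of phi'. Write phi' = p / alpha with the flux
    p = alpha phi'; the oscillation of p is controlled by p' = 2 beta L phi,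
    that of alpha by its derivative in L^2, and sup |p| by the W^{1,2} norm of
    p. The Kirchhoff condition supplies a continuous representative of phi'.
*)
Require Import Defs.
From HB Require Import structures.
From mathcomp Require Import all_boot all_order all_algebra.
From mathcomp Require Import all_classical all_reals all_analysis.
From mathcomp.real_closed Require Import complex.
From mathcomp Require Import measurable_realfun ring lra.
Set Implicit Arguments.
Unset Strict Implicit.
Unset Printing Implicit Defensive.
Import Order.TTheory GRing.Theory Num.Theory.
Import numFieldNormedType.Exports.
Local Open Scope classical_set_scope.
Local Open Scope ring_scope.

Local Notation mu := lebesgue_measure.

(** * C^1 cut-off functions *)

(** The square of the error on a cell is at most [h] times the integral over that cell of a fixed
    integrable density. This bound is constant on the cell, so integrating it over the length [h]
    produces the second factor [h], and the cells add up. Only the square integral of the derivative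
    of alpha enters, because that derivative may blow up near an interior vertex. Weak derivatives
    are defined by C^1 test functions supported inside the open edge and are chosen up to null sets,
    whereas interpolation uses point values up to the vertices. Point values are recovered by
    testing against explicit quadratic splines; continuity carries the resulting identity to the end
    points, and uniqueness almost everywhere allows representatives to be exchanged. The estimates
    produce the mesh size of each edge, while [h] is the smallest of them; the factor [kappa] makes
    up for the difference. *)

Lemma is_derive_quadratic_error (R : realType) (f : R -> R) (x l M : R) :
  (forall h, `|f (x + h) - f x - l * h| <= M * h ^+ 2) -> is_derive x 1 f l.
Proof.
move=> fM.
have M1 : 0 < M + 1.
  rewrite ltr_wpDl//; have := fM 1; rewrite expr1n (mulr1 M); exact: le_trans (normr_ge0 _).
have cvl : h^-1 *: (f (h *: 1 + x) - f x) @[h --> 0^'] --> l.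
  apply/cvgrPdist_le => e e0; near=> h.
  have h0 : h != 0 by near: h; exact: nbhs_dnbhs_neq.
  have -> : l - h^-1 *: (f (h *: (1 : R) + x) - f x) =
     - (h^-1 * (f (x + h) - f x - l * h)).
    rewrite /GRing.scale /= mulr1 (addrC h x); field; exact: h0.
  rewrite normrN normrM normfV.
  rewrite ler_pdivrMl ?normr_gt0//.
  apply: (le_trans (fM h)).
  rewrite -normr_id -real_normK ?num_real// expr2 normr_id mulrA.
  rewrite (mulrC `|h| e) ler_wpM2r//.
  rewrite (le_trans (_ : _ <= (M + 1) * `|h|))//.
    by rewrite ler_wpM2r// lerDl.
  rewrite mulrC -ler_pdivlMr//.
  near: h; apply: (@dnbhs0_le R R^o); exact: divr_gt0.
split; first by apply/cvg_ex; exists l.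
by apply: cvg_lim.
Unshelve. all: by end_near. Qed.

(** The first-order remainder is at most [h ^+ 2] for every choice of signs of [x] and [x + h], so
    the kink at 0, where the second derivative jumps, needs no limit argument of its own. *)
Lemma is_derive_mulnorm (R : realType) (x : R) :
  is_derive x 1 (fun t : R => t * `|t|) (2 * `|x|).
Proof.
apply: (@is_derive_quadratic_error _ _ _ _ 1) => h; rewrite mul1r.
rewrite ler_norml.
have [x0|x0] := leP 0 x; have [xh|xh] := leP 0 (x + h);
  rewrite ?(ger0_norm x0) ?(ger0_norm xh) ?(ltr0_norm x0) ?(ltr0_norm xh);
  apply/andP; split; nra.
Qed.

(* [tent] is the hat function on [0, 2] and [ramp] its primitive, written
   without case distinctions. *)
Definition tent (R : realType) (t : R) : R :=
  (`|t| - 2 * `|t - 1| + `|t - 2|) / 2.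

Definition ramp (R : realType) (t : R) : R :=
  2^-1 + (t * `|t| - 2 * ((t - 1) * `|t - 1|) + (t - 2) * `|t - 2|) / 4.

Lemma is_derive_ramp1 (R : realType) (t : R) : is_derive t 1 (@ramp R) (tent t).
Proof.
have d1 (z : R) : is_derive t 1 (fun t => (t - z) * `|t - z|) (2 * `|t - z|).
  have := @is_derive1_comp _ (fun t => t * `|t|) (fun t => t - z) t _ 1
    (is_derive_mulnorm (t - z)).
  rewrite mulr1; apply.
  by apply: is_derive_eq; rewrite oppr0 addr0.
have := d1 0; rewrite subr0 (_ : (fun t => _) = (fun t => t * `|t|)); last first.
  by apply/funext => s; rewrite subr0.
move=> d0; have d2 := d1 2; have {}d1 := d1 1.
rewrite /ramp /tent; apply: is_derive_eq.
by rewrite /GRing.scale/=; field.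
Qed.

(** For [c > 0] the derivative is a bump of mass one supported in [[y, y + 2/c]]: an approximate
    identity at [y], from the right, as [c] grows. *)
Lemma is_derive_ramp (R : realType) (c y t : R) :
  is_derive t 1 (fun t => ramp (c * (t - y))) (c * tent (c * (t - y))).
Proof.
have := @is_derive1_comp _ (@ramp R) (fun t => c * (t - y)) t _ c
  (is_derive_ramp1 (c * (t - y))).
rewrite mulrC; apply.
by apply: is_derive_eq; rewrite oppr0 addr0 /GRing.scale/= mulr1.
Qed.

Lemma continuous_tent (R : realType) : continuous (@tent R).
Proof.
move=> t; rewrite /tent; apply: cvgMl; apply: cvgD; first apply: cvgB.
- exact: cvg_norm.
- by apply: cvgMr; apply: cvg_norm; apply: cvgB => //; exact: cvg_cst.
- by apply: cvg_norm; apply: cvgB => //; exact: cvg_cst.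
Qed.

Lemma tent_ge0 (R : realType) (t : R) : 0 <= tent t.
Proof.
rewrite /tent.
have [x0|x0] := leP 0 t; have [x1|x1] := leP 0 (t - 1);
  have [x2|x2] := leP 0 (t - 2);
  rewrite ?(ger0_norm x0) ?(ger0_norm x1) ?(ger0_norm x2)
     ?(ltr0_norm x0) ?(ltr0_norm x1) ?(ltr0_norm x2); lra.
Qed.

Lemma tent_out (R : realType) (t : R) : t <= 0 \/ 2 <= t -> tent t = 0.
Proof.
rewrite /tent.
have [x0|x0] := leP 0 t; have [x1|x1] := leP 0 (t - 1);
  have [x2|x2] := leP 0 (t - 2);
  rewrite ?(ger0_norm x0) ?(ger0_norm x1) ?(ger0_norm x2)
     ?(ltr0_norm x0) ?(ltr0_norm x1) ?(ltr0_norm x2); case=> ?; lra.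
Qed.

(** For [t <= 0] the numerator is the second difference of [- t ^+ 2] with step 1, that is -2; the
    constant [2^-1] in [ramp] cancels it. *)
Lemma ramp_le0 (R : realType) (t : R) : t <= 0 -> ramp t = 0.
Proof.
move=> t0; rewrite /ramp (ler0_norm t0) !ler0_norm; try lra; by field.
Qed.

Lemma ramp_ge2 (R : realType) (t : R) : 2 <= t -> ramp t = 1.
Proof.
move=> t2; rewrite /ramp !ger0_norm; try lra; by field.
Qed.

Lemma ramp_itv01 (R : realType) (t : R) : 0 <= ramp t <= 1.
Proof.
have [t0|t0] := leP t 0; first by rewrite ramp_le0// lexx ler01.
have [t2|t2] := leP 2 t; first by rewrite ramp_ge2// lexx ler01.
rewrite /ramp (gtr0_norm t0) (ltr0_norm (_ : t - 2 < 0)); last lra.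
have [t1|t1] := leP 0 (t - 1).
  by rewrite (ger0_norm t1); apply/andP; split; nra.
by rewrite (ltr0_norm t1); apply/andP; split; nra.
Qed.

(** * Fundamental theorem of calculus for continuous functions with a weak derivative *)

Lemma Rintegral_subset0 (R : realType) (A B : set R) (f : R -> R) :
  A `<=` B -> (forall x, B x -> ~ A x -> f x = 0) ->
  \int[mu]_(x in B) f x = \int[mu]_(x in A) f x.
Proof.
move=> AB f0; rewrite [LHS]Rintegral_mkcond [RHS]Rintegral_mkcond.
congr (Rintegral _ _ _); apply/funext => x; rewrite /patch.
case: ifPn => [xB|]; case: ifPn => // xA.
  by apply: f0; [exact: set_mem|move/mem_set; exact/negP].
by rewrite notin_setE => nB; move: xA => /set_mem/AB.
Qed.

Lemma within_continuous_integrable (R : realType) (a b : R) (f : R -> R) :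
  {within `[a, b], continuous f} -> mu.-integrable `[a, b] (EFin \o f).
Proof.
by move=> cf; apply: continuous_compact_integrable => //; exact: segment_compact.
Qed.

Lemma itvcc_integrable_cst (R : realType) (a b k : R) :
  mu.-integrable `[a, b] (EFin \o cst k).
Proof.
apply: within_continuous_integrable; apply: continuous_subspaceT => x.
exact: cvg_cst.
Qed.

Lemma within_continuousM (R : realType) (D : set R) (f g : R -> R) :
  {within D, continuous f} -> {within D, continuous g} ->
  {within D, continuous (fun x => f x * g x)}.
Proof. by move=> cf cg x; apply: cvgM; [exact: cf|exact: cg]. Qed.

Lemma continuous_affine_tent (R : realType) (c y : R) :
  continuous (fun t => c * tent (c * (t - y))).
Proof.
move=> t; apply: cvgMr.
apply: (@continuous_comp _ _ _ (fun t => c * (t - y)) (@tent R)); last first.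
  exact: continuous_tent.
by apply: cvgMr; apply: cvgB; [exact: cvg_id|exact: cvg_cst].
Qed.

Lemma Rintegral_is_derive (R : realType) (F f : R -> R) (y z : R) : y < z ->
  (forall x : R, is_derive x 1 F (f x)) -> continuous f ->
  \int[mu]_(t in `[y, z]) f t = F z - F y.
Proof.
move=> yz dF cf.
have cF : continuous F.
  move=> x; apply: differentiable_continuous; apply/derivable1_diffP.
  by have [] := dF x.
rewrite /Rintegral (@continuous_FTC2 _ _ F)//.
- exact/continuous_subspaceT.
- split.
  + by move=> x _; have [] := dF x.
  + exact/cvg_at_right_filter/cF.
  + exact/cvg_at_left_filter/cF.
- by move=> x _; rewrite derive1E; have [] := dF x.
Qed.

(** The kernel is nonnegative, has mass one and lives to the right of [y]. Hence the integral lies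
    between those of [(u y - e)] and [(u y + e)] times the kernel, as soon as the support fits in
    the ball where [u] is within [e] of [u y]. *)
Lemma tent_mollify (R : realType) (u : R -> R) (y0 y z : R) :
  y0 <= y -> y < z -> {within `[y0, z], continuous u} ->
  {for y, continuous u} ->
  \int[mu]_(t in `[y0, z]) (u t * (n.+1%:R * tent (n.+1%:R * (t - y))))
    @[n --> \oo] --> u y.
Proof.
move=> y0y yz cu cuy; have y0z : y0 < z := le_lt_trans y0y yz.
apply/cvgrPdist_le => e e0.
move/cvgrPdist_le : (cuy) => /(_ e e0) /nbhs_ballP[/= r r0 ru].
near=> n.
have n0 : 0 < n.+1%:R :> R by [].
(* The support has length [2 / n.+1]: being shorter than [r] it stays in the ball, being shorter
   than [z - y] it keeps all the mass inside [[y0, z]]. *)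
have nr : 2 < n.+1%:R * Num.min r (z - y).
  rewrite mulrC -ltr_pdivrMl// ?lt_min ?r0 ?subr_gt0//.
  apply: (@lt_trans _ _ n%:R); last by rewrite ltr_nat.
  rewrite mulrC; near: n; exact: nbhs_infty_gtr.
pose k t := n.+1%:R * tent (n.+1%:R * (t - y)).
have k0 t : 0 <= k t by rewrite mulr_ge0// tent_ge0.
have ck : {within `[y0, z], continuous k}.
  exact/continuous_subspaceT/continuous_affine_tent.
have ik : \int[mu]_(t in `[y0, z]) k t = 1.
  rewrite (Rintegral_is_derive y0z (is_derive_ramp n.+1%:R y)); last first.
    exact: continuous_affine_tent.
  rewrite ramp_ge2 ?ramp_le0 ?subr0//.
    by rewrite pmulr_rle0// subr_le0.
  rewrite (le_trans (ltW nr))// ler_wpM2l// ge_min.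
  by rewrite lexx orbT.
have kout t : ~ ball y r t -> k t = 0.
  move=> nb; rewrite /k tent_out ?mulr0//.
  move: nb; rewrite /ball/= => /negP; rewrite -leNgt => rt.
  have [ty|ty] := leP t y; [left|right].
    by rewrite pmulr_rle0// subr_le0.
  rewrite (le_trans (ltW nr))// ler_wpM2l//.
  rewrite ge_min; apply/orP; left; move: rt.
  by rewrite ltr0_norm ?subr_lt0// opprB.
have uk t : `|u t * k t - u y * k t| <= e * k t.
  rewrite -mulrBl normrM (ger0_norm (k0 t)).
  have [/ru yt|/kout ->] := pselect (ball y r t); last by rewrite !mulr0.
  by rewrite ler_wpM2r// distrC.
have intk : mu.-integrable `[y0, z] (EFin \o k) by exact: within_continuous_integrable.
have intc (c : R) : mu.-integrable `[y0, z] (EFin \o (fun t => c * k t)).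
  apply: within_continuous_integrable; apply: within_continuousM => //.
  by apply: continuous_subspaceT => ?; exact: cvg_cst.
have intu : mu.-integrable `[y0, z] (EFin \o (fun t => u t * k t)).
  by apply: within_continuous_integrable; exact: within_continuousM.
have cE (c : R) : \int[mu]_(t in `[y0, z]) (c * k t) = c.
  by rewrite RintegralZl//= ik mulr1.
rewrite distrC ler_distl; apply/andP; split.
  rewrite -[leLHS]cE; apply: le_Rintegral => //= t _.
  by move: (uk t); rewrite ler_distl -mulrBl => /andP[].
rewrite -[leRHS]cE; apply: le_Rintegral => //= t _.
by move: (uk t); rewrite ler_distl -mulrDl => /andP[].
Unshelve. all: by end_near. Qed.

(* The test functions [psi n] increase from 0 to 1 near [y] and back near [z],
   and converge pointwise to the indicator function of ]y, z]. *)
Lemma weak_derivative_itvoo_FTC2 (R : realType) (a b : R) (u g : R -> R) (y z : R) :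
  {in `]a, b[, continuous u} -> real_weak_derivative a b u g ->
  a < y -> y <= z -> z < b -> u z - u y = \int[mu]_(t in `[y, z]) g t.
Proof.
move=> cu [ug wd] ay; rewrite le_eqVlt => /predU1P[->|yz] zb.
  by rewrite subrr set_itv1 Rintegral_set1.
(* The second ramp acts to the right of [z], so the support of [psi n] needs room between [z] and
   [b]. *)
pose z' := (z + b) / 2.
have zz' : z < z' by rewrite /z'; lra.
have z'b : z' < b by rewrite /z'; lra.
have yz'ab : `[y, z'] `<=` `]a, b[.
  by apply: subset_itvSoo; rewrite bnd_simp.
have cyz' : {within `[y, z'], continuous u}.
  by apply: continuous_in_subspaceT => x /set_mem/yz'ab xab; exact: cu.
pose psi n t := ramp (n.+1%:R * (t - y)) - ramp (n.+1%:R * (t - z)).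
pose k n s t : R := n.+1%:R * tent (n.+1%:R * (t - s)).
have dpsi (n : nat) (t : R) : is_derive t 1 (psi n) (k n y t - k n z t).
  have dy := is_derive_ramp n.+1%:R y t.
  have dz := is_derive_ramp n.+1%:R z t.
  exact: is_deriveB.
have dpsiE n : derive1 (psi n) = fun t => k n y t - k n z t.
  by apply/funext => t; rewrite derive1E; have [] := dpsi n t.
have ck n s : continuous (k n s) by exact: continuous_affine_tent.
have cpsi n : continuous (psi n).
  move=> x; apply: differentiable_continuous; apply/derivable1_diffP.
  by have [] := dpsi n x.
have [_ ig] := ug y z' ay z'b.
have psi1 n t : `|psi n t| <= 1.
  rewrite /psi ler_norml.
  have /andP[? ?] := ramp_itv01 (n.+1%:R * (t - y)).
  have /andP[? ?] := ramp_itv01 (n.+1%:R * (t - z)).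
  by apply/andP; split; lra.
have large (s : R) : 0 < s -> \forall n \near \oo, 2 <= n.+1%:R * s.
  move=> s0; near=> m; rewrite mulrC -ler_pdivrMl//.
  rewrite (@le_trans _ _ m%:R)//; last by rewrite ler_nat.
  rewrite mulrC; near: m; exact: nbhs_infty_ger.
have supp : \forall n \near \oo, forall t, t \notin `[y, z'] ->
    [/\ psi n t = 0, k n y t = 0 & k n z t = 0].
  near=> n => t; rewrite in_itv/= negb_and -!ltNge => yzt.
  have nz : 2 <= n.+1%:R * (z' - z) by near: n; apply: large; rewrite subr_gt0.
  have n0 : 0 < n.+1%:R :> R by [].
  case/orP : yzt => [ty|z't].
    have ny0 : n.+1%:R * (t - y) <= 0 by rewrite pmulr_rle0// subr_le0 ltW.
    have nz0 : n.+1%:R * (t - z) <= 0.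
      by rewrite pmulr_rle0// subr_le0 ltW// (lt_trans ty).
    by rewrite /psi /k !ramp_le0// !tent_out ?mulr0 ?subrr//; left.
  have nz2 : 2 <= n.+1%:R * (t - z).
    by rewrite (le_trans nz)// ler_pM2l// lerB// ltW.
  have ny2 : 2 <= n.+1%:R * (t - y).
    by rewrite (le_trans nz2)// ler_pM2l// lerB// ltW.
  by rewrite /psi /k !ramp_ge2// !tent_out ?mulr0 ?subrr//; right.
(* The derivative of [psi n] is the kernel at [y] minus the kernel at [z], so mollification applies
   to each term. *)
have lhs : \int[mu]_(t in `]a, b[) (u t * derive1 (psi n) t) @[n --> \oo]
    --> u y - u z.
  have : \int[mu]_(t in `[y, z']) (u t * k n y t) -
         \int[mu]_(t in `[y, z']) (u t * k n z t) @[n --> \oo] --> u y - u z.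
    apply: cvgB; apply: tent_mollify => //.
    - exact: lt_trans zz'.
    - by apply: cu; rewrite in_itv/= ay (lt_trans yz).
    - exact: ltW.
    - by apply: cu; rewrite in_itv/= (lt_trans ay yz).
  apply: cvg_trans; apply: near_eq_cvg; near=> n.
  rewrite [RHS](@Rintegral_subset0 _ `[y, z'])//.
    rewrite dpsiE -RintegralB//.
    - by apply: eq_Rintegral => t _; rewrite mulrBr.
    - apply: within_continuous_integrable; apply: within_continuousM => //.
      exact/continuous_subspaceT.
    - apply: within_continuous_integrable; apply: within_continuousM => //.
      exact/continuous_subspaceT.
  move=> t _ /negP yzt; rewrite dpsiE.
  have [//|_ -> ->] := near supp n _ t yzt; last by rewrite subrr mulr0.
have rhs : \int[mu]_(t in `]a, b[) (g t * psi n t) @[n --> \oo]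
    --> \int[mu]_(t in `[y, z]) g t.
  have mg : measurable_fun `[y, z'] g.
    by apply/measurable_EFinP; case/integrableP : ig.
  have mgpsi n : measurable_fun `[y, z'] (fun t => g t * psi n t).
    apply: measurable_funM => //; apply: measurable_funTS.
    exact: continuous_measurable_fun.
  (* At each point [psi n] is eventually constant. At [y] and at [z] both ramps are treated from the
     left, where they vanish, which gives a limit 0 at [y] and 1 at [z]: hence the half-open
     interval. Domination is by [|g|]. *)
  pose G t := g t * \1_(`]y, z]) t.
  have mG : measurable_fun `[y, z'] G.
    by apply: measurable_funM => //; apply: measurable_indic.
  have iGg : \int[mu]_(t in `[y, z']) G t = \int[mu]_(t in `[y, z]) g t.
    rewrite (@Rintegral_subset0 _ `]y, z]).
    - rewrite -Rintegral_itv_obnd_cbnd; last first.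
        by apply: integrableS ig => //; apply: subset_itv; rewrite bnd_simp// ltW.
      apply: eq_Rintegral => t tyz.
      by rewrite /G indicE tyz mulr1.
    - by apply: subset_itv; rewrite bnd_simp// ltW.
    - by move=> t _ tyz; rewrite /G indicE memNset// mulr0.
  have mE (f : R -> R) : measurable_fun `[y, z'] f ->
    measurable_fun `[y, z'] (EFin \o f) by move=> ?; exact/measurable_EFinP.
  have [] := @dominated_convergence _ _ R mu `[y, z'] (measurable_itv _)
    (fun n t => (g t * psi n t)%:E) (EFin \o G) (fun t => `|g t|%:E)
    (fun n => mE _ (mgpsi n)) (mE _ mG).
  - apply: aeW => t _; apply: cvg_EFin; first exact: nearW.
    apply: cvgMr; rewrite indicE.
    apply: cvg_near_cst; rewrite /psi mem_setE in_itv/=.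
    have [ty|yt] := leP t y; have [tz|zt] := leP t z => /=; near=> n.
    + by rewrite !ramp_le0 ?subrr// pmulr_rle0// subr_le0.
    + by have := lt_le_trans zt ty; rewrite ltNge (ltW yz).
    + rewrite ramp_ge2 ?ramp_le0 ?subr0// ?pmulr_rle0// ?subr_le0//.
      by near: n; apply: large; rewrite subr_gt0.
    + by rewrite !ramp_ge2 ?subrr//; near: n; apply: large; rewrite subr_gt0.
  - exact: integrable_norm ig.
  - apply: aeW => t n _; rewrite /= lee_fin normrM ler_piMr//.
  move=> iG _ dcv.
  rewrite -iGg.
  have : \int[mu]_(t in `[y, z']) (g t * psi n t) @[n --> \oo]
      --> \int[mu]_(t in `[y, z']) G t.
    by apply: fine_cvg; rewrite fineK; [exact: dcv|exact: integrable_fin_num].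
  apply: cvg_trans; apply: near_eq_cvg; near=> n.
  rewrite [RHS](@Rintegral_subset0 _ `[y, z'])//.
  move=> t _ /negP yzt.
  by have [//|-> _ _] := near supp n _ t yzt; rewrite mulr0.
have eqs : \forall n \near \oo, - (\int[mu]_(t in `]a, b[) (g t * psi n t)) =
    \int[mu]_(t in `]a, b[) (u t * derive1 (psi n) t).
  near=> n; apply/esym.
  apply: (wd _ y z') => //.
  - by rewrite dpsiE => t; apply: cvgB; exact: ck.
  - by move=> t yzt; have [//|-> _ _] := near supp n _ t yzt.
have : u y - u z = - \int[mu]_(t in `[y, z]) g t.
  apply: (cvg_unique _ lhs) => //.
  by apply: cvg_trans (cvgN rhs); exact: near_eq_cvg eqs.
by move=> uyz; rewrite -[RHS]opprK -uyz opprB.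
Unshelve. all: by end_near. Qed.

(** * Calculus of weak derivatives *)

Lemma derive1_eq0_near (R : realType) (f : R -> R) (x l : R) :
  (\near x, f x = l) -> derive1 f x = 0.
Proof.
move=> fl; rewrite derive1E -(@near_eq_derive _ _ _ (cst l)) ?derive_cst//.
by near do apply/esym.
Unshelve. all: by end_near. Qed.

Lemma derive1_out (R : realType) (psi : R -> R) (c d : R) :
  (forall z, z \notin `[c, d] -> psi z = 0) ->
  forall z, z \notin `[c, d] -> derive1 psi z = 0.
Proof.
move=> psi0 z zcd; apply: (@derive1_eq0_near _ _ _ 0).
have /open_nbhs_nbhs : open_nbhs z (~` `[c, d]).
  split; last by move/negP : zcd.
  exact/closed_openC/interval_closed.
by apply: filterS => t /negP; exact: psi0.
Qed.

Lemma integrableM_within_continuous (R : realType) (c d : R) (u f : R -> R) :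
  mu.-integrable `[c, d] (EFin \o u) -> {within `[c, d], continuous f} ->
  mu.-integrable `[c, d] (EFin \o (fun x => u x * f x)).
Proof.
move=> iu cf.
have -> : EFin \o (fun x => u x * f x) = ((EFin \o f) \* (EFin \o u))%E.
  by apply/funext => x; rewrite /= mulrC.
apply: integrableMr => //.
  by apply: subspace_continuous_measurable_fun => //; exact: measurable_itv.
have : bounded_set (f @` `[c, d]).
  exact/compact_bounded/continuous_compact/segment_compact.
rewrite /bounded_set /bounded_near/=.
by apply: filterS => M fM x cdx; apply: fM; exists x.
Qed.

(** The shape [k * u1 + u2] yields differences, with [k = -1], as well as finite combinations of hat
    functions, by induction. *)
Lemma real_weak_derivative_lin (R : realType) (a b k : R) (u1 g1 u2 g2 : R -> R) :
  real_weak_derivative a b u1 g1 -> real_weak_derivative a b u2 g2 ->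
  real_weak_derivative a b (fun z => k * u1 z + u2 z) (fun z => k * g1 z + g2 z).
Proof.
move=> [i1 w1] [i2 w2].
have lin c d (f1 f2 : R -> R) : mu.-integrable `[c, d] (EFin \o f1) ->
    mu.-integrable `[c, d] (EFin \o f2) ->
    mu.-integrable `[c, d] (EFin \o (fun z => k * f1 z + f2 z)).
  move=> if1 if2.
  have -> : EFin \o (fun z => k * f1 z + f2 z) =
    (fun z => k%:E * (EFin \o f1) z + (EFin \o f2) z)%E by apply/funext.
  by apply: integrableD => //; exact: integrableZl.
split=> [c d ac db|psi c d ac db dpsi cpsi psi0].
  have [iu1 ig1] := i1 c d ac db; have [iu2 ig2] := i2 c d ac db.
  by split; exact: lin.
have [iu1 ig1] := i1 c d ac db; have [iu2 ig2] := i2 c d ac db.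
have cdab : `[c, d] `<=` `]a, b[ by apply: subset_itvSoo; rewrite bnd_simp.
(* Stated for a continuous [h] supported in [[c, d]], because it serves once with [h = derive1 psi]
   and once with [h = psi]. *)
have key (f1 f2 h : R -> R) : mu.-integrable `[c, d] (EFin \o f1) ->
    mu.-integrable `[c, d] (EFin \o f2) -> continuous h ->
    (forall z, z \notin `[c, d] -> h z = 0) ->
    \int[mu]_(z in `]a, b[) ((k * f1 z + f2 z) * h z) =
    k * \int[mu]_(z in `]a, b[) (f1 z * h z) + \int[mu]_(z in `]a, b[) (f2 z * h z).
  move=> if1 if2 ch h0.
  rewrite !(@Rintegral_subset0 _ `[c, d] `]a, b[)//; try by move=> x _ /negP/h0 ->; rewrite mulr0.
  have ifh f : mu.-integrable `[c, d] (EFin \o f) ->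
      mu.-integrable `[c, d] (EFin \o (fun z => f z * h z)).
    move=> if_; apply: integrableM_within_continuous => //.
    exact: continuous_subspaceT.
  rewrite -RintegralZl//; last exact: ifh.
  rewrite -RintegralD//; [|exact: (integrableZl _ _ (ifh _ if1))|exact: ifh].
  - by apply: eq_Rintegral => x _; rewrite mulrDl mulrA.
rewrite key//; last exact: derive1_out.
rewrite key//; last first.
  move=> x; apply: differentiable_continuous; exact/derivable1_diffP.
by rewrite (w1 psi c d)// (w2 psi c d)// mulrN opprD.
Qed.

(** By Lebesgue differentiation [h] is almost everywhere the derivative of its primitive from [c],
    and this primitive vanishes. Extension by zero makes [h] locally integrable on the whole
    line. *)
Lemma integral0_ae0_itvcc (R : realType) (c d : R) (h : R -> R) :
  mu.-integrable `[c, d] (EFin \o h) ->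
  (forall y z, c <= y -> y <= z -> z <= d -> \int[mu]_(t in `[y, z]) h t = 0) ->
  {ae mu, forall x, x \in `]c, d[ -> h x = 0}.
Proof.
move=> ih h0.
pose f := h \_ `[c, d].
have if_ (y : R) : mu.-integrable `[c, y] (EFin \o f).
  rewrite /f -restrict_EFin; apply/integrable_restrict => //.
  apply: integrableS ih => //; first exact: measurableI.
have lf : locally_integrable [set: R] f by exact: integrable_locally.
have := FTC1 if_ lf; apply: filterS; first exact: (ae_filter_ringOfSetsType mu).
move=> x Fx xcd.
have [|_] := Fx; first by move: xcd; rewrite in_itv/= => /andP[+ _]; rewrite -lte_fin.
rewrite (@derive1_eq0_near _ _ _ 0).
  rewrite /f patchE mem_set//=; apply: subset_itv_oo_cc xcd.
near=> y.
have ycd : y \in `]c, d[ by near: y; exact: near_in_itvoo.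
rewrite (_ : \int[mu]_(t in `[c, y]) f t = \int[mu]_(t in `[c, y]) h t).
  by apply: h0; rewrite ?lexx ?(itvP ycd).
apply: eq_Rintegral => t; rewrite inE/= => tcy.
rewrite /f patchE mem_set//=; move: tcy; apply: subset_itvl.
by rewrite bnd_simp (itvP ycd).
Unshelve. all: by end_near. Qed.

(** The difference is a weak derivative of 0, so its integrals over compact subintervals vanish.
    Integrability up to [a] and [b] is not part of the definition, hence the countable exhaustion of
    []a, b[]. *)
Lemma real_weak_derivative_unique (R : realType) (a b : R) (u g1 g2 : R -> R) :
  real_weak_derivative a b u g1 -> real_weak_derivative a b u g2 ->
  {ae mu, forall x, x \in `]a, b[ -> g1 x = g2 x}.
Proof.
move=> w1 w2.
have := real_weak_derivative_lin (-1) w1 w2.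
rewrite (_ : (fun z => _) = cst 0) => [[ih w]|]; last first.
  by apply/funext => z; rewrite mulN1r addNr.
pose h z := -1 * g1 z + g2 z.
have h0 (n : nat) : {ae mu, forall x, x \in `]a + n.+1%:R^-1, b - n.+1%:R^-1[ ->
    h x = 0}.
  have n0 : 0 < n.+1%:R^-1 :> R by rewrite invr_gt0.
  apply: integral0_ae0_itvcc => [|y z ay yz zb].
    by have [] := ih (a + n.+1%:R^-1) (b - n.+1%:R^-1); rewrite ?ltrDl ?gtrBl.
  rewrite -(@weak_derivative_itvoo_FTC2 _ a b (cst 0)) ?subrr//.
  - by move=> x _; exact: cvg_cst.
  - by rewrite (lt_le_trans _ ay)// ltrDl.
  - by rewrite (le_lt_trans zb)// gtrBl.
have := ae_foralln h0; apply: filterS.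
move=> x hx xab.
have m0 : 0 < Num.min (x - a) (b - x) by rewrite lt_min !subr_gt0 !(itvP xab).
have [n _ /(_ n (leqnn n))/= nx] := near_infty_natSinv_lt (PosNum m0).
have : h x = 0.
  apply: (hx n); rewrite in_itv/=; move: nx.
  rewrite lt_min; move: (n.+1%:R^-1) => e /andP[? ?].
  by apply/andP; split; lra.
by rewrite /h mulN1r => /eqP; rewrite addrC subr_eq0 => /eqP.
Qed.

(** The sign of [z - c], with the value -1 at [c] so that it is constant on both pieces [[A, c]] and
    []c, B]] of a split integral. *)
Definition sgnl (R : realType) (c z : R) : R := if z <= c then -1 else 1.

Lemma measurable_sgnl (R : realType) (D : set R) (c : R) :
  measurable_fun D (sgnl c).
Proof.
apply: measurable_funTS.
apply: measurable_fun_ifT => //; exact: measurable_fun_ler.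
Qed.

Lemma sgnl_integrable (R : realType) (x y c : R) :
  mu.-integrable `[x, y] (EFin \o sgnl c).
Proof.
apply: measurable_bounded_integrable => //=.
- by rewrite lebesgue_measure_itv/=; case: ifP => _; rewrite ?ltry.
- exact: measurable_sgnl.
- exists 1; split => // M M1 z _ /=; rewrite /sgnl.
  by case: ifP => _; rewrite ?normrN normr1 ltW.
Qed.

(** Classical integration by parts on each side of the kink; the boundary terms at [c] vanish
    because [|z - c|] does. All weak derivatives of piecewise linear functions are deduced from this
    one. *)
Lemma real_weak_derivative_norm (R : realType) (a b c : R) :
  real_weak_derivative a b (fun z => `|z - c|) (sgnl c).
Proof.
have cn : continuous (fun z : R => `|z - c|).
  move=> x; apply: cvg_norm; apply: cvgB => //; exact: cvg_cst.
split=> [c' d' ac' d'b|psi c' d' ac' d'b dpsi cpsi psi0].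
  split; last exact: sgnl_integrable.
  by apply: within_continuous_integrable; exact: continuous_subspaceT.
have cpsi0 : continuous psi.
  by move=> x; apply: differentiable_continuous; exact/derivable1_diffP.
have psi'0 := derive1_out psi0.
(* The kink may lie outside []a, b[], as it does for a hat centred at an end node. The interval
   [[A, B]] contains both the kink and the support of [psi] in its interior; it may exceed []a, b[],
   since the integrands vanish off the support. *)
pose A := Num.min c' c - 1; pose B := Num.max d' c + 1.
have [Ac' Ac] : A < c' /\ A < c.
  have : Num.min c' c <= c' by rewrite ge_min lexx.
  have : Num.min c' c <= c by rewrite ge_min lexx orbT.
  by rewrite /A; split; lra.
have [d'B cB] : d' < B /\ c < B.
  have : d' <= Num.max d' c by rewrite le_max lexx.
  have : c <= Num.max d' c by rewrite le_max lexx orbT.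
  by rewrite /B; split; lra.
have supp (f : R -> R) : (forall z, z \notin `[c', d'] -> f z = 0) ->
    \int[mu]_(z in `]a, b[) f z = \int[mu]_(z in `[A, B]) f z.
  move=> f0; rewrite (@Rintegral_subset0 _ `[c', d'])//.
  - rewrite [RHS](@Rintegral_subset0 _ `[c', d'])//.
      by apply: subset_itv; rewrite bnd_simp ltW.
    by move=> x _ /negP; exact: f0.
  - by apply: subset_itvSoo; rewrite bnd_simp.
  - by move=> x _ /negP; exact: f0.
rewrite supp; last by move=> z /psi'0 ->; rewrite mulr0.
rewrite supp; last by move=> z /psi0 ->; rewrite mulr0.
apply/eqP; rewrite -addr_eq0.
have i1 : mu.-integrable `[A, B] (EFin \o (fun z => `|z - c| * derive1 psi z)).
  apply: within_continuous_integrable; apply: within_continuousM;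
  exact: continuous_subspaceT.
have i2 : mu.-integrable `[A, B] (EFin \o (fun z => sgnl c z * psi z)).
  apply: integrableM_within_continuous; first exact: sgnl_integrable.
  exact: continuous_subspaceT.
rewrite -RintegralD//.
have psiA : psi A = 0 by apply: psi0; rewrite in_itv/= leNgt Ac'.
have psiB : psi B = 0 by apply: psi0; rewrite in_itv/= (leNgt B) d'B andbF.
have dpsiE (x : R) : is_derive x 1 psi (derive1 psi x).
  by rewrite derive1E; apply: DeriveDef.
(* With [s] the sign on the given side of [c], [F s] is [|z - c| * psi z] there, and it is C^1 on
   the whole line. *)
pose F (s z : R) : R := s * (z - c) * psi z.
pose f (s z : R) : R := s * (z - c) * derive1 psi z + s * psi z.
have dF (s x : R) : is_derive x 1 (F s) (f s x).
  have dx : is_derive x 1 (fun z => s * (z - c)) s.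
    by apply: is_derive_eq; rewrite oppr0 addr0 /GRing.scale/= mulr1.
  apply: is_derive_eq; rewrite /f /GRing.scale/=; ring.
have cf s : continuous (f s).
  move=> x; apply: cvgD; last by apply: cvgMr; exact: cpsi0.
  apply: cvgM; last exact: cpsi.
  by apply: cvgMr; apply: cvgB => //; exact: cvg_cst.
rewrite -(subrK (\int[mu]_(z in `[A, c]) (`|z - c| * derive1 psi z + sgnl c z * psi z))
  (\int[mu]_(z in `[A, B]) _)).
rewrite Rintegral_itvB; last 3 first.
  - rewrite (_ : _ \o _ = ((EFin \o (fun z => `|z - c| * derive1 psi z)%R) \+
       (EFin \o (fun z => sgnl c z * psi z)%R))%E).
      exact: integrableD.
    by apply/funext.
  - by rewrite bnd_simp ltW.
  - by rewrite bnd_simp ltW.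
apply/eqP.
have -> : \int[mu]_(z in `]c, B]) (`|z - c| * derive1 psi z + sgnl c z * psi z) =
    \int[mu]_(z in `]c, B]) f 1 z.
  apply: eq_Rintegral => z; rewrite inE/= in_itv/= => /andP[cz _].
  by rewrite /f /sgnl leNgt cz/= !mul1r gtr0_norm ?subr_gt0.
have -> : \int[mu]_(z in `[A, c]) (`|z - c| * derive1 psi z + sgnl c z * psi z) =
    \int[mu]_(z in `[A, c]) f (-1) z.
  apply: eq_Rintegral => z; rewrite inE/= in_itv/= => /andP[_ cz].
  by rewrite /f /sgnl cz/= ler0_norm ?subr_le0// !mulN1r.
rewrite Rintegral_itv_obnd_cbnd; last first.
  have icB : mu.-integrable `[c, B] (EFin \o f 1).
    by apply: within_continuous_integrable; exact: continuous_subspaceT.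
  by apply: integrableS icB => //; exact: subset_itv_oc_cc.
rewrite (Rintegral_is_derive cB (dF 1))// (Rintegral_is_derive Ac (dF (-1)))//.
by rewrite /F psiA psiB subrr !mulr0 !mul0r !subrr addr0.
Qed.

(** * Oscillation estimates *)

Lemma itv_prefix_const (R : realType) (a b : R) (P : R -> R) : a < b ->
  {within `[a, b], continuous P} ->
  (forall y z, a < y -> y <= z -> z < b -> P y = P z) ->
  forall y z, y \in `[a, b] -> z \in `[a, b] -> P y = P z.
Proof.
move=> ab /(continuous_within_itvP _ ab)[_ Pa Pb] Pc.
pose m := (a + b) / 2.
have [am mb] : a < m /\ m < b by rewrite /m; split; lra.
have Pm y : y \in `]a, b[ -> P y = P m.
  rewrite in_itv/= => /andP[ay yb].
  by have [ym|/ltW my] := leP y m; [exact: Pc|apply/esym; exact: Pc].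
have PaE : P a = P m.
  apply: (cvg_unique _ Pa) => //.
  apply: cvg_near_cst; near=> t; apply: Pm.
  rewrite in_itv/=; apply/andP; split.
    by near: t; exact: nbhs_right_gt.
  by near: t; exact: nbhs_right_lt.
have PbE : P b = P m.
  apply: (cvg_unique _ Pb) => //.
  apply: cvg_near_cst; near=> t; apply: Pm.
  rewrite in_itv/=; apply/andP; split.
    by near: t; exact: nbhs_left_gt.
  by near: t; exact: nbhs_left_lt.
have Pall y : y \in `[a, b] -> P y = P m.
  rewrite in_itv/= le_eqVlt => /andP[/predU1P[<- //|ay]].
  rewrite le_eqVlt => /predU1P[->//|yb].
  by apply: Pm; rewrite in_itv/= ay.
by move=> y z /Pall-> /Pall->.
Unshelve. all: by end_near. Qed.

(** The function [u] minus the primitive of [g] is continuous on [[a, b]] and constant inside, hence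
    constant. The end points matter because the vertices are interpolation nodes. *)
Lemma FTC2_itvoo_itvcc (R : realType) (a b : R) (u g : R -> R) : a < b ->
  {within `[a, b], continuous u} -> mu.-integrable `[a, b] (EFin \o g) ->
  (forall y z, a < y -> y <= z -> z < b -> u z - u y = \int[mu]_(t in `[y, z]) g t) ->
  forall y z, a <= y -> y <= z -> z <= b -> u z - u y = \int[mu]_(t in `[y, z]) g t.
Proof.
move=> ab cu ig ug.
have iI y z : a <= y -> z <= b -> mu.-integrable `[y, z] (EFin \o g).
  move=> ay zb; apply: integrableS ig => //.
  by apply: subset_itv; rewrite bnd_simp.
have itvB y z : a <= y -> y <= z -> z <= b ->
    \int[mu]_(t in `[a, z]) g t - \int[mu]_(t in `[a, y]) g t =
    \int[mu]_(t in `[y, z]) g t.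
  move=> ay yz zb; rewrite Rintegral_itvB ?bnd_simp//.
    rewrite Rintegral_itv_obnd_cbnd//.
    by apply: integrableS (iI y z ay zb) => //; exact: subset_itv_oc_cc.
  exact: iI.
have := @itv_prefix_const _ a b (fun t => u t - \int[mu]_(s in `[a, t]) g s) ab.
move=> Pc y z ay yz zb.
have yab : y \in `[a, b] by rewrite in_itv/= ay (le_trans yz).
have zab : z \in `[a, b] by rewrite in_itv/= zb (le_trans ay).
rewrite -itvB//.
suff : u y - \int[mu]_(s in `[a, y]) g s = u z - \int[mu]_(s in `[a, z]) g s by lra.
apply: Pc => //.
  move=> t; apply: cvgB; first exact: cu.
  exact: (parameterized_integral_continuous (ltW ab) ig).
move=> s t al st tb.
have := ug _ _ al st tb.
rewrite -itvB//; [lra|exact: ltW|exact: ltW].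
Qed.

Lemma weak_derivative_FTC2 (R : realType) (a b : R) (u g : R -> R) : a < b ->
  {within `[a, b], continuous u} -> mu.-integrable `[a, b] (EFin \o g) ->
  real_weak_derivative a b u g ->
  forall y z, a <= y -> y <= z -> z <= b -> u z - u y = \int[mu]_(t in `[y, z]) g t.
Proof.
move=> ab cu ig wd; apply: FTC2_itvoo_itvcc => // y z.
apply: weak_derivative_itvoo_FTC2 => //.
by have [] := (continuous_within_itvP _ ab).1 cu.
Qed.

(** Meant for the coefficient alpha, whose derivative is continuous only inside the edge and may be
    unbounded near its ends; [g] is its derivative with freely chosen values elsewhere. *)
Lemma derive_FTC2 (R : realType) (a b : R) (u g : R -> R) : a < b ->
  {within `[a, b], continuous u} -> mu.-integrable `[a, b] (EFin \o g) ->
  {in `]a, b[, forall z, derivable u z 1} ->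
  {in `]a, b[, continuous (derive1 u)} ->
  {in `]a, b[, g =1 derive1 u} ->
  forall y z, a <= y -> y <= z -> z <= b -> u z - u y = \int[mu]_(t in `[y, z]) g t.
Proof.
move=> ab cu ig du cu' gu; apply: FTC2_itvoo_itvcc => // y z ay.
rewrite le_eqVlt => /predU1P[->|yz] zb; first by rewrite subrr set_itv1 Rintegral_set1.
have sub t : t \in `[y, z] -> t \in `]a, b[.
  by apply: subset_itvSoo; rewrite bnd_simp.
have cont t : t \in `[y, z] -> {for t, continuous u}.
  by move=> /sub/du/derivable1_diffP/differentiable_continuous.
rewrite (_ : \int[mu]_(t in _) g t = \int[mu]_(t in `[y, z]) derive1 u t); last first.
  by apply: eq_Rintegral => t; rewrite inE => /sub; exact: gu.
rewrite /Rintegral (@continuous_FTC2 _ _ u)//.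
- by apply: continuous_in_subspaceT => t /set_mem/sub; exact: cu'.
- split.
  + by move=> t tyz; apply: du; apply: sub; exact: subset_itv_oo_cc tyz.
  + by apply: cvg_at_right_filter; apply: cont; rewrite in_itv/= lexx ltW.
  + by apply: cvg_at_left_filter; apply: cont; rewrite in_itv/= lexx ltW.
Qed.

(** Because [|g| <= 1 + g ^+ 2] and the interval is bounded. Applied to a square, it passes from the
    fourth power to the second. *)
Lemma sqr_integrable (R : realType) (y z : R) (g : R -> R) :
  measurable_fun `[y, z] g ->
  mu.-integrable `[y, z] (EFin \o (fun t => g t ^+ 2)) ->
  mu.-integrable `[y, z] (EFin \o g).
Proof.
move=> mg ig2.
have i1 : mu.-integrable `[y, z] (EFin \o (fun t => 1 + g t ^+ 2)).
  have -> : EFin \o (fun t => 1 + g t ^+ 2) =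
    ((EFin \o cst 1%R) \+ (EFin \o (fun t => g t ^+ 2)%R))%E by apply/funext.
  by apply: integrableD => //; exact: itvcc_integrable_cst.
apply: le_integrable i1 => //; first exact/measurable_EFinP.
move=> t _ /=; rewrite lee_fin (ger0_norm (_ : 0 <= 1 + _)); last first.
  by rewrite addr_ge0// sqr_ge0.
by rewrite -real_normK ?num_real//; nra.
Qed.

Lemma lebesgue_measure_itvcc (R : realType) (y z : R) : y < z ->
  lebesgue_measure (`[y, z] : set R) = (z - y)%:E.
Proof. by move=> yz; rewrite lebesgue_measure_itv/= lte_fin yz. Qed.

(** Integrating [(g - m) ^+ 2 >= 0] with [m] the mean of [g], then multiplying by [z - y]. *)
Lemma Rintegral_cauchy_schwarz (R : realType) (y z : R) (g : R -> R) : y <= z ->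
  measurable_fun `[y, z] g ->
  mu.-integrable `[y, z] (EFin \o (fun t => g t ^+ 2)) ->
  (\int[mu]_(t in `[y, z]) g t) ^+ 2 <= (z - y) * \int[mu]_(t in `[y, z]) g t ^+ 2.
Proof.
rewrite le_eqVlt => /predU1P[-> _ _|yz mg ig2].
  by rewrite set_itv1 !Rintegral_set1 expr0n mulr0.
have ig := sqr_integrable mg ig2.
set I := \int[mu]_(t in _) g t; set Q := \int[mu]_(t in _) _.
pose m := I / (z - y).
have icst (k : R) := itvcc_integrable_cst y z k.
have : 2 * m * I - m ^+ 2 * (z - y) <= Q.
  have -> : 2 * m * I - m ^+ 2 * (z - y) =
      \int[mu]_(t in `[y, z]) (2 * m * g t - m ^+ 2).
    rewrite RintegralB//; [|exact: (integrableZl _ (2 * m) ig)|exact: icst].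
    rewrite RintegralZl// Rintegral_cst//; congr (_ - _ * _).
    exact: (congr1 fine (esym (lebesgue_measure_itvcc yz))).
  apply: le_Rintegral => //.
    rewrite (_ : _ \o _ = ((fun t => (2 * m)%:E * (EFin \o g) t) \- (EFin \o cst (m ^+ 2)%R))%E).
      by apply: integrableB => //; exact: integrableZl.
    by apply/funext.
  by move=> t _; have := sqr_ge0 (g t - m); rewrite sqrrB; lra.
rewrite -(ler_pM2l (_ : 0 < z - y)) ?subr_gt0//; apply: le_trans.
have zy : z - y != 0 by rewrite subr_eq0 gt_eqF.
by rewrite le_eqVlt; apply/orP; left; apply/eqP; rewrite /m; field.
Qed.

Lemma ge0_subset_Rintegral (R : realType) (y z y' z' : R) (f : R -> R) :
  y' <= y -> z <= z' -> mu.-integrable `[y', z'] (EFin \o f) ->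
  (forall t, 0 <= f t) ->
  \int[mu]_(t in `[y, z]) f t <= \int[mu]_(t in `[y', z']) f t.
Proof.
move=> yy zz ifn f0.
have sub : `[y, z] `<=` `[y', z'] by apply: subset_itv; rewrite bnd_simp.
rewrite fine_le//.
- apply: integrable_fin_num => //; exact: integrableS ifn.
- exact: integrable_fin_num.
- apply: ge0_subset_integral => //; first by case/integrableP : ifn.
  by move=> t _; rewrite lee_fin.
Qed.

(** The bound involves the whole of [[x, x']], so it is uniform in the two points [y] and [z]; on a
    mesh cell it becomes a constant. *)
Lemma FTC2_oscillation (R : realType) (a b : R) (u g : R -> R) :
  measurable_fun `[a, b] g ->
  mu.-integrable `[a, b] (EFin \o (fun t => g t ^+ 2)) ->
  (forall y z, a <= y -> y <= z -> z <= b -> u z - u y = \int[mu]_(t in `[y, z]) g t) ->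
  forall x x' y z, a <= x -> x' <= b -> y \in `[x, x'] -> z \in `[x, x'] ->
  (u z - u y) ^+ 2 <= (x' - x) * \int[mu]_(t in `[x, x']) g t ^+ 2.
Proof.
move=> mg ig ug x x' y z ax xb.
wlog yz : y z / y <= z => [hw yx zx|].
  have [yz|/ltW zy] := leP y z; first exact: hw.
  by rewrite -sqrrN opprB; exact: hw.
rewrite !in_itv/= => /andP[xy yx'] /andP[xz zx'].
have ay := le_trans ax xy; have zb := le_trans zx' xb.
rewrite ug//.
have sub : `[y, z] `<=` `[a, b] by apply: subset_itv; rewrite bnd_simp.
apply: le_trans (Rintegral_cauchy_schwarz yz _ _) _.
- exact: measurable_funS mg.
- exact: integrableS ig.
apply: ler_pM; rewrite ?subr_ge0//.
- by apply: Rintegral_ge0 => t _; exact: sqr_ge0.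
- exact: lerB.
- apply: ge0_subset_Rintegral => //; last by move=> t; exact: sqr_ge0.
  by apply: integrableS ig => //; apply: subset_itv; rewrite bnd_simp.
Qed.

(** Induction on the number of cells, splitting off the last one. The pointwise bound is asked on
    open cells only, as slopes jump at the nodes, and the integrals are extended reals, so that
    integrability of [F] is a consequence. *)
Lemma mesh_integral_le (R : realType) (a h : R) (N : nat) (F G : R -> R) (b : R) : 0 < h ->
  b = a + N%:R * h -> measurable_fun `[a, b] F ->
  (forall t, 0 <= F t) -> (forall t, 0 <= G t) ->
  mu.-integrable `[a, b] (EFin \o G) ->
  (forall j, (j < N)%N -> forall z, z \in `]a + j%:R * h, a + j.+1%:R * h[ ->
    F z <= h * \int[mu]_(t in `[a + j%:R * h, a + j.+1%:R * h]) G t) ->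
  (\int[mu]_(t in `[a, b]) (F t)%:E <=
   (h ^+ 2)%:E * \int[mu]_(t in `[a, b]) (G t)%:E)%E.
Proof.
move=> h0 + + F0 G0; elim: N b => [|N IH] b -> mF iG FG.
  by rewrite mul0r addr0 set_itv1 !integral_set1 mule0.
set x := a + N%:R * h; set x' := a + N.+1%:R * h.
have xx' : x' = x + h by rewrite /x' /x -natr1; ring.
have xltx' : x < x' by rewrite xx' ltrDl.
have ax : a <= x by rewrite lerDl mulr_ge0// ltW.
have split : [set` `[a, x']] = [set` `[a, x]] `|` [set` `]x, x']].
  by rewrite -itv_bndbnd_setU// bnd_simp// ltW.
have mG : measurable_fun `[a, x'] G by apply/measurable_EFinP; case/integrableP : iG.
have sub1 : `[a, x] `<=` `[a, x'] by apply: subset_itvl; rewrite bnd_simp ltW.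
have sub2 : `[x, x'] `<=` `[a, x'] by apply: subset_itvr; rewrite bnd_simp.
have iG2 : mu.-integrable `[x, x'] (EFin \o G) by apply: integrableS iG.
have splitI (f : R -> R) : (forall t, 0 <= f t) -> measurable_fun `[a, x'] f ->
    (\int[mu]_(t in `[a, x']) (f t)%:E = \int[mu]_(t in `[a, x]) (f t)%:E +
     \int[mu]_(t in `[x, x']) (f t)%:E)%E.
  move=> f0 mf; rewrite [in LHS]split ge0_integral_setU//=.
  - congr (_ + _)%E; apply: integral_itv_obnd_cbnd.
    apply/measurable_EFinP; apply: measurable_funS mf => //.
    by apply: subset_itvr; rewrite bnd_simp.
  - by rewrite -split; exact/measurable_EFinP.
  - by move=> t _; rewrite lee_fin.
  - rewrite disj_set2E; apply/eqP; rewrite -subset0 => t [] /=.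
    by rewrite !in_itv/= => /andP[_ tx] /andP[xt _]; have := lt_le_trans xt tx; rewrite ltxx.
rewrite splitI// splitI// ge0_muleDr//; try by apply: integral_ge0 => t _; rewrite lee_fin.
apply: leeD.
  apply: IH.
  - by [].
  - exact: measurable_funS mF.
  - exact: integrableS iG.
  - by move=> j jN; apply: FG; exact: ltnW.
set W := h * \int[mu]_(t in `[x, x']) G t.
have -> : (\int[mu]_(t in `[x, x']) (G t)%:E)%E = (\int[mu]_(t in `[x, x']) G t)%:E.
  by rewrite /Rintegral fineK//; exact: integrable_fin_num.
rewrite integral_itv_bndoo; last first.
  apply/measurable_EFinP; apply: measurable_funS mF => //.
  by apply: subset_trans sub2; exact: subset_itv_oo_cc.
apply: (@le_trans _ _ (\int[mu]_(t in `]x, x'[) (cst W%:E) t)%E).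
  apply: ge0_le_integral => //.
  - by move=> t _; rewrite lee_fin.
  - apply/measurable_EFinP; apply: measurable_funS mF => //.
    by apply: subset_trans sub2; exact: subset_itv_oo_cc.
  - by move=> t tx; rewrite lee_fin; exact: FG.
rewrite integral_cst//= -EFinM.
rewrite [X in (_ * X)%E](_ : _ = (x' - x)%:E); last first.
  by have := @lebesgue_measure_itv R `]x, x'[; rewrite /= lte_fin xltx' EFinB.
by rewrite -EFinM lee_fin /W xx' (addrC x) addrK expr2 mulrAC.
Qed.

(** * Piecewise linear functions *)

(** The formula of [hatE] with [sgnl y z] in place of each [|z - y|]. *)
Definition dhat (R : realType) (c s z : R) : R :=
  (sgnl (c - s) z - 2 * sgnl c z + sgnl (c + s) z) / (2 * s).

(** The hat is a scaled second difference of the absolute value; in this form its continuity and its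
    weak derivative follow by linearity. *)
Lemma hatE (R : realType) (c s z : R) : 0 < s ->
  hat c s z = (`|z - (c - s)| - 2 * `|z - c| + `|z - (c + s)|) / (2 * s).
Proof.
move=> s0; rewrite /hat.
have -> : 1 - `|z - c| / s = (2 * s - 2 * `|z - c|) / (2 * s).
  by field; rewrite gt_eqF.
rewrite -(mul0r (2 * s)^-1) -maxr_pMl; last by rewrite invr_ge0 mulr_ge0// ltW.
congr (_ / _).
have [x0|x0] := leP 0 (z - c); have [x1|x1] := leP 0 (z - (c - s));
  have [x2|x2] := leP 0 (z - (c + s));
  rewrite ?(ger0_norm x0) ?(ger0_norm x1) ?(ger0_norm x2)
     ?(ltr0_norm x0) ?(ltr0_norm x1) ?(ltr0_norm x2);
  (have [?|?] := leP 0 (2 * s - 2 * _)); lra.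
Qed.

Lemma continuous_hat (R : realType) (c s : R) : 0 < s -> continuous (hat c s).
Proof.
move=> s0 z.
rewrite (_ : hat c s = (fun z => (`|z - (c - s)| - 2 * `|z - c| + `|z - (c + s)|) / (2 * s))).
  have cn (y : R) : (fun z : R => `|z - y|) t @[t --> z] --> `|z - y|.
    by apply: cvg_norm; apply: cvgB => //; exact: cvg_cst.
  by apply: cvgMl; apply: cvgD => //; apply: cvgB => //; exact: cvgMr.
by apply/funext => t; exact: hatE.
Qed.

Lemma real_weak_derivative0 (R : realType) (a b : R) :
  real_weak_derivative a b (cst 0) (cst 0).
Proof.
have := real_weak_derivative_lin (-1) (real_weak_derivative_norm a b 0) (real_weak_derivative_norm a b 0).
by congr real_weak_derivative; apply/funext => z; rewrite mulN1r addNr.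
Qed.

Lemma real_weak_derivative_hat (R : realType) (a b c s : R) : 0 < s ->
  real_weak_derivative a b (hat c s) (dhat c s).
Proof.
move=> s0.
have wn y := real_weak_derivative_norm a b y.
have := real_weak_derivative_lin (2 * s)^-1 (wn (c - s))
  (real_weak_derivative_lin (- 2 / (2 * s)) (wn c)
    (real_weak_derivative_lin (2 * s)^-1 (wn (c + s)) (real_weak_derivative0 a b))).
congr real_weak_derivative; apply/funext => z.
  by rewrite hatE//=; field; rewrite gt_eqF.
by rewrite /dhat/=; field; rewrite gt_eqF.
Qed.

(** All [N + 1] nodes are treated alike: the hats at the two end nodes extend beyond the interval,
    which does not affect the values on it. *)
Definition pwlin (R : realType) (a h : R) (N : nat) (c : nat -> R) (z : R) : R :=
  \sum_(0 <= j < N.+1) c j * hat (a + j%:R * h) h z.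

Definition dpwlin (R : realType) (a h : R) (N : nat) (c : nat -> R) (z : R) : R :=
  \sum_(0 <= j < N.+1) c j * dhat (a + j%:R * h) h z.

Lemma real_weak_derivative_pwlin (R : realType) (a b x h : R) (N : nat) (c : nat -> R) :
  0 < h -> real_weak_derivative a b (pwlin x h N c) (dpwlin x h N c).
Proof.
move=> h0; rewrite /pwlin /dpwlin; elim: N.+1 => [|n IH].
  rewrite (_ : (fun z => _) = cst 0); last by apply/funext => z; rewrite big_nil.
  rewrite (_ : (fun z => _) = cst 0); last by apply/funext => z; rewrite big_nil.
  exact: real_weak_derivative0.
have := real_weak_derivative_lin (c n) (real_weak_derivative_hat a b (x + n%:R * h) h0) IH.
by congr real_weak_derivative; apply/funext => z; rewrite [RHS]big_nat_recr//= addrC.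
Qed.

Lemma continuous_pwlin (R : realType) (a h : R) (N : nat) (c : nat -> R) :
  0 < h -> continuous (pwlin a h N c).
Proof.
move=> h0; rewrite /pwlin; elim: N.+1 => [|n IH] z.
  rewrite (_ : (fun z => _) = cst 0); last by apply/funext => t; rewrite big_nil.
  exact: cvg_cst.
rewrite (_ : (fun z => _) = (fun z => \sum_(0 <= j < n) c j * hat (a + j%:R * h) h z +
  c n * hat (a + n%:R * h) h z)); last by apply/funext => t; rewrite big_nat_recr.
by apply: cvgD; [exact: IH|apply: cvgMr; exact: continuous_hat].
Qed.

(** Isolates, on the cell number [j], the hats of its two end nodes. *)
Lemma big_nat_pair (V : zmodType) (N j : nat) (F : nat -> V) : (j < N)%N ->
  (forall i, i != j -> i != j.+1 -> F i = 0) ->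
  \sum_(0 <= i < N.+1) F i = F j + F j.+1.
Proof.
move=> jN F0; rewrite (@big_cat_nat _ _ _ j)//=; last by rewrite ltnW// ltnW.
rewrite big_nat_cond big1 ?add0r; last first.
  by move=> i /andP[/andP[_ ij] _]; rewrite F0// ltn_eqF// ltnW.
rewrite big_ltn; last exact: ltnW.
rewrite big_ltn// big_nat_cond big1 ?addr0//.
by move=> i /andP[/andP[ij _] _]; rewrite F0// gtn_eqF// ltnW.
Qed.

(** Measured in cells, the distance to node [i] is [|j - i + t|], which is at least 1 unless [i] is
    [j] or [j + 1]. *)
Lemma pwlin_cell (R : realType) (a h : R) (N : nat) (c : nat -> R) (j : nat) (t : R) :
  0 < h -> (j < N)%N -> 0 <= t <= 1 ->
  pwlin a h N c (a + j%:R * h + t * h) = (1 - t) * c j + t * c j.+1.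
Proof.
move=> h0 jN /andP[t0 t1].
have hatE' i : hat (a + i%:R * h) h (a + j%:R * h + t * h) =
    Num.max 0 (1 - `|j%:R - i%:R + t|).
  rewrite /hat; congr (Num.max _ (_ - _)).
  rewrite (_ : _ - _ = (j%:R - i%:R + t) * h); last by ring.
  by rewrite normrM (gtr0_norm h0) mulfK// gt_eqF.
rewrite /pwlin (big_nat_pair jN).
  rewrite !hatE' subrr add0r -natr1 ger0_norm// opprD addrA subrr sub0r.
  rewrite ler0_norm; last lra.
  rewrite !max_r; [ring|lra|lra].
move=> i ij ij1; rewrite hatE' max_l ?mulr0//.
have [lij|lji|eij] := ltngtP i j; last by rewrite eij eqxx in ij.
  have : i.+1%:R <= j%:R :> R by rewrite ler_nat.
  rewrite -natr1 => ?; rewrite ger0_norm; lra.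
have : j.+2%:R <= i%:R :> R by rewrite ler_nat ltn_neqAle lji eq_sym ij1.
rewrite -!natr1 => ?; rewrite ler0_norm; lra.
Qed.

(** The kinks of the hats all lie on the uniform grid, so every [sgnl] is constant on an open cell.
    For hats of other nodes the three signs agree, and their weights 1, -2, 1 add up to 0. *)
Lemma dpwlin_cell (R : realType) (a h : R) (N : nat) (c : nat -> R) (j : nat) (z : R) :
  0 < h -> (j < N)%N -> z \in `]a + j%:R * h, a + j.+1%:R * h[ ->
  dpwlin a h N c z = (c j.+1 - c j) / h.
Proof.
move=> h0 jN; rewrite in_itv/= => /andP[jz zj].
have hn : h != 0 by rewrite gt_eqF.
have sL (x : R) : x <= a + j%:R * h -> sgnl x z = 1.
  by move=> xj; rewrite /sgnl leNgt (le_lt_trans xj).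
have sR (x : R) : a + j.+1%:R * h <= x -> sgnl x z = -1.
  by move=> jx; rewrite /sgnl (le_trans (ltW zj)).
have shift i : a + i.+1%:R * h = a + i%:R * h + h by rewrite -natr1; ring.
have mono i k : (i <= k)%N -> a + i%:R * h <= a + k%:R * h.
  by move=> ik; rewrite lerD2l ler_pM2r// ler_nat.
have monoS i k : (i < k)%N -> a + i%:R * h + h <= a + k%:R * h.
  by move=> ik; rewrite -shift mono.
rewrite /dpwlin (big_nat_pair jN).
  rewrite /dhat (sL (a + j%:R * h - h)) ?(sL (a + j%:R * h)) ?(sR (a + j%:R * h + h)).
  rewrite (sL (a + j.+1%:R * h - h)) ?(sR (a + j.+1%:R * h)) ?(sR (a + j.+1%:R * h + h)).
  - by field.
  - by rewrite lerDl ltW.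
  - by [].
  - by rewrite shift addrK.
  - by rewrite shift.
  - by [].
  - by rewrite gerBl ltW.
move=> i ij ij1; apply/eqP; rewrite mulf_eq0; apply/orP; right; apply/eqP.
have [lij|lji|eij] := ltngtP i j; last by rewrite eij eqxx in ij.
  have ? := mono i j (ltnW lij); have ? := monoS i j lij.
  rewrite /dhat (sL (_ - h)) ?(sL (_ + h)) ?(sL (a + i%:R * h)); lra.
have ji : (j.+2 <= i)%N by rewrite ltn_neqAle lji eq_sym ij1.
have ? := mono j.+1 i lji; have ? := monoS j.+1 i ji.
rewrite /dhat (sR (_ - h)) ?(sR (_ + h)) ?(sR (a + i%:R * h)); lra.
Qed.

(** * Interpolation errors of real functions on one interval *)

Lemma mesh_cell_subset (R : realType) (a b h : R) (N j : nat) : 0 < h ->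
  b = a + N%:R * h -> (j < N)%N ->
  a <= a + j%:R * h /\ a + j.+1%:R * h <= b.
Proof.
move=> h0 -> jN; split; first by rewrite lerDl mulr_ge0// ltW.
by rewrite lerD2l ler_pM2r// ler_nat.
Qed.

Lemma mesh_cell_length (R : realType) (a h : R) (j : nat) :
  a + j.+1%:R * h - (a + j%:R * h) = h.
Proof. by rewrite -natr1; ring. Qed.

(** On a cell the error at [z] is a convex combination of [u x - u z] and [u x' - u z], both bounded
    by the oscillation of [u]. *)
Lemma pwlin_L2_error (R : realType) (a b h : R) (N : nat) (u g : R -> R) :
  0 < h -> (0 < N)%N -> b = a + N%:R * h ->
  {within `[a, b], continuous u} -> measurable_fun `[a, b] g ->
  mu.-integrable `[a, b] (EFin \o (fun t => g t ^+ 2)) ->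
  real_weak_derivative a b u g ->
  (\int[mu]_(z in `[a, b]) ((pwlin a h N (fun j => u (a + j%:R * h)) z - u z) ^+ 2)%:E
    <= (h ^+ 2)%:E * \int[mu]_(z in `[a, b]) (g z ^+ 2)%:E)%E.
Proof.
move=> h0 N0 bE cu mg ig wd.
have ab : a < b by rewrite bE ltrDl mulr_gt0// ltr0n.
have ug := weak_derivative_FTC2 ab cu (sqr_integrable mg ig) wd.
apply: (mesh_integral_le h0 bE).
- apply: measurable_funX; apply: measurable_funB.
    apply: measurable_funTS; apply: continuous_measurable_fun.
    exact: continuous_pwlin.
  exact: subspace_continuous_measurable_fun.
- by move=> t; exact: sqr_ge0.
- by move=> t; exact: sqr_ge0.
- exact: ig.
move=> j jN z /subset_itv_oo_cc zj.
have [aj jb] := mesh_cell_subset h0 bE jN.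
set x := a + j%:R * h in zj aj *; set x' := a + j.+1%:R * h in zj jb *.
have xx' : x' - x = h by exact: mesh_cell_length.
pose t := (z - x) / h.
have zE : z = x + t * h by rewrite /t divfK ?gt_eqF//; lra.
have t01 : 0 <= t <= 1.
  move: zj; rewrite in_itv/= => /andP[? ?].
  by rewrite /t divr_ge0 ?subr_ge0 ?(ltW h0)//= ler_pdivrMr// mul1r; lra.
rewrite [X in pwlin _ _ _ _ X]zE pwlin_cell//.
rewrite -/x -/x'.
have osc y : y \in `[x, x'] -> (u y - u z) ^+ 2 <= h * \int[mu]_(t in `[x, x']) g t ^+ 2.
  by move=> yx; rewrite -xx'; exact: (FTC2_oscillation mg ig ug).
have xle : x <= x' by lra.
have := osc x; rewrite in_itv/= lexx xle => /(_ isT) ox.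
have := osc x'; rewrite in_itv/= lexx xle => /(_ isT) ox'.
case/andP : t01 => t0 t1.
(* Convexity of the square; the gap between the two sides is [t * (1 - t) * (u x - u x') ^+ 2]. *)
apply: (@le_trans _ _ ((1 - t) * (u x - u z) ^+ 2 + t * (u x' - u z) ^+ 2)).
  rewrite -subr_ge0.
  rewrite (_ : _ - _ = t * (1 - t) * (u x - u x') ^+ 2); last by ring.
  by rewrite mulr_ge0 ?sqr_ge0// mulr_ge0// subr_ge0.
rewrite -[leRHS]mul1r -[X in _ <= X * _](subrK t 1) [leRHS]mulrDl.
by apply: lerD; apply: ler_wpM2l => //; rewrite subr_ge0.
Qed.

(** All values of [g] on the open interval lie within [w = Num.sqrt W] of [g z], and so does their
    mean. *)
Lemma mean_oscillation (R : realType) (x x' W : R) (g : R -> R) : x < x' ->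
  mu.-integrable `[x, x'] (EFin \o g) ->
  (forall y z, y \in `]x, x'[ -> z \in `]x, x'[ -> (g y - g z) ^+ 2 <= W) ->
  forall z, z \in `]x, x'[ ->
  ((\int[mu]_(t in `[x, x']) g t) / (x' - x) - g z) ^+ 2 <= W.
Proof.
move=> xx' ig gW z zx.
have W0 : 0 <= W by apply: le_trans (gW z z zx zx); exact: sqr_ge0.
pose w := Num.sqrt W.
have w2 : w ^+ 2 = W by rewrite sqr_sqrtr.
have w0 : 0 <= w by rewrite sqrtr_ge0.
have gw t : t \in `]x, x'[ -> g z - w <= g t <= g z + w.
  move=> tx; rewrite -ler_distl -(@ler_pXn2r _ 2) ?nnegrE//.
  by rewrite real_normK ?num_real// w2; exact: gW.
have L0 : 0 < x' - x by rewrite subr_gt0.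
have ig' : mu.-integrable `]x, x'[ (EFin \o g).
  by apply: integrableS ig => //; exact: subset_itv_oo_cc.
have Ioo : \int[mu]_(t in `[x, x']) g t = \int[mu]_(t in `]x, x'[) g t.
  rewrite /Rintegral integral_itv_bndoo//.
  by apply/measurable_EFinP; case/integrableP : ig' => /measurable_EFinP.
have icst (k : R) : mu.-integrable `]x, x'[ (EFin \o cst k).
  by apply: integrableS (itvcc_integrable_cst x x' k) => //; exact: subset_itv_oo_cc.
have Icst (k : R) : \int[mu]_(t in `]x, x'[) k = k * (x' - x).
  rewrite Rintegral_cst//; congr (_ * _).
  have E : lebesgue_measure (`]x, x'[ : set R) = (x' - x)%:E.
    by rewrite lebesgue_measure_itv/= lte_fin xx' EFinB.
  exact: (congr1 fine E).
have lo : (g z - w) * (x' - x) <= \int[mu]_(t in `[x, x']) g t.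
  rewrite Ioo -Icst; apply: le_Rintegral => //; first exact: icst.
  by move=> t /gw/andP[].
have hi : \int[mu]_(t in `[x, x']) g t <= (g z + w) * (x' - x).
  rewrite Ioo -Icst; apply: le_Rintegral => //; first exact: icst.
  by move=> t /gw/andP[].
rewrite -w2 -real_normK ?num_real// ler_pXn2r ?nnegrE//.
by rewrite ler_distl ler_pdivlMr// ler_pdivrMr// lo hi.
Qed.

(** The density [G] is left abstract: all that is asked of [g] is an oscillation bound, on open
    intervals because alpha is bounded below only inside the edge. *)
Lemma dpwlin_L2_error (R : realType) (a b h : R) (N : nat) (u g G : R -> R) :
  0 < h -> (0 < N)%N -> b = a + N%:R * h ->
  {within `[a, b], continuous u} -> measurable_fun `[a, b] g ->
  mu.-integrable `[a, b] (EFin \o g) ->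
  real_weak_derivative a b u g ->
  (forall t, 0 <= G t) -> mu.-integrable `[a, b] (EFin \o G) ->
  (forall x x' y z, a <= x -> x' <= b -> y \in `]x, x'[ -> z \in `]x, x'[ ->
    (g y - g z) ^+ 2 <= (x' - x) * \int[mu]_(t in `[x, x']) G t) ->
  measurable_fun `[a, b] (dpwlin a h N (fun j => u (a + j%:R * h))) ->
  (\int[mu]_(z in `[a, b]) ((dpwlin a h N (fun j => u (a + j%:R * h)) z - g z) ^+ 2)%:E
    <= (h ^+ 2)%:E * \int[mu]_(z in `[a, b]) (G z)%:E)%E.
Proof.
move=> h0 N0 bE cu mg ig wd G0 iG gG md.
have ab : a < b by rewrite bE ltrDl mulr_gt0// ltr0n.
have ug := weak_derivative_FTC2 ab cu ig wd.
apply: (mesh_integral_le h0 bE) => //.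
- by apply: measurable_funX; apply: measurable_funB.
- by move=> t; exact: sqr_ge0.
move=> j jN z zj; rewrite (dpwlin_cell _ h0 jN)//.
have [aj jb] := mesh_cell_subset h0 bE jN.
have xx' := mesh_cell_length a h j.
have jj : a + j%:R * h < a + j.+1%:R * h by rewrite -subr_gt0 xx'.
rewrite ug//; last exact: ltW.
set W := h * _.
have := @mean_oscillation _ _ _ W g jj; rewrite xx'; apply => //.
  by apply: integrableS ig => //; apply: subset_itv; rewrite bnd_simp.
by move=> y y' yx y'x; rewrite /W -[X in X * _]xx'; exact: gG.
Qed.

Lemma measurable_dpwlin (R : realType) (D : set R) (a h : R) (N : nat) (c : nat -> R) :
  measurable_fun D (dpwlin a h N c).
Proof.
apply: measurable_sum => j; apply: measurable_funM => //.
apply: measurable_funM => //.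
apply: measurable_funD; last exact: measurable_sgnl.
apply: measurable_funB; first exact: measurable_sgnl.
by apply: measurable_funM => //; exact: measurable_sgnl.
Qed.

(* Integrate p(t)^2 <= 2 p(s)^2 + 2 (p(t) - p(s))^2 in s. *)
Lemma sqr_sup_le (R : realType) (a b : R) (p q : R -> R) : a < b ->
  {within `[a, b], continuous p} -> measurable_fun `[a, b] q ->
  mu.-integrable `[a, b] (EFin \o (fun t => q t ^+ 2)) ->
  (forall y z, a <= y -> y <= z -> z <= b -> p z - p y = \int[mu]_(t in `[y, z]) q t) ->
  forall t, t \in `[a, b] -> p t ^+ 2 <=
    2 / (b - a) * \int[mu]_(s in `[a, b]) p s ^+ 2 +
    2 * (b - a) * \int[mu]_(s in `[a, b]) q s ^+ 2.
Proof.
move=> ab cp mq iq pq t tab.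
set Q := \int[mu]_(s in `[a, b]) q s ^+ 2.
have L0 : 0 < b - a by rewrite subr_gt0.
have cp2 : {within `[a, b], continuous (fun s => p s ^+ 2)}.
  by move=> s; apply: cvgM; exact: cp.
have ip := within_continuous_integrable cp2.
have icst (k : R) := itvcc_integrable_cst a b k.
have cstE (k : R) : \int[mu]_(s in `[a, b]) k = k * (b - a).
  rewrite Rintegral_cst//; congr (_ * _).
  exact: (congr1 fine (lebesgue_measure_itvcc ab)).
have : \int[mu]_(s in `[a, b]) (p t ^+ 2) <=
    \int[mu]_(s in `[a, b]) (2 * p s ^+ 2 + 2 * ((b - a) * Q)).
  apply: le_Rintegral => //; first exact: icst.
    rewrite (_ : _ \o _ = ((fun s => 2%:E * (EFin \o (fun s => p s ^+ 2)%R) s) \+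
       (EFin \o cst (2 * ((b - a) * Q))%R))%E).
      by apply: integrableD => //; exact: integrableZl.
    by apply/funext.
  move=> s sab; have := FTC2_oscillation mq iq pq (lexx a) (lexx b) sab tab.
  rewrite -/Q.
  by have := sqr_ge0 (p t - 2 * p s); rewrite !sqrrB; nra.
rewrite cstE RintegralD//; [|exact: (integrableZl _ 2 ip)|exact: icst].
rewrite RintegralZl// cstE -ler_pdivlMr// => /le_trans; apply.
by rewrite le_eqVlt; apply/orP; left; apply/eqP; field; rewrite gt_eqF.
Qed.

(* al1 (g1 - g2) = (al1 g1 - al2 g2) - (al1 - al2) g2. *)
Lemma sqr_quotientB_le (R : realType) (c P al1 al2 g1 g2 : R) : 0 < c ->
  c <= al1 -> c <= al2 -> (al2 * g2) ^+ 2 <= P ->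
  (g1 - g2) ^+ 2 <= 2 / c ^+ 2 * (al1 * g1 - al2 * g2) ^+ 2 +
    2 * P / c ^+ 4 * (al1 - al2) ^+ 2.
Proof.
move=> c0 cal1 cal2 P2.
have c2 : 0 < c ^+ 2 by rewrite exprn_gt0.
have g2P : g2 ^+ 2 <= P / c ^+ 2.
  rewrite ler_pdivlMr// mulrC (le_trans _ P2)// exprMn ler_wpM2r ?sqr_ge0//.
  by rewrite ler_pXn2r ?nnegrE ?(ltW c0)// (le_trans (ltW c0)).
have P0 : 0 <= P by rewrite (le_trans _ P2)// sqr_ge0.
have -> : 2 / c ^+ 2 * (al1 * g1 - al2 * g2) ^+ 2 + 2 * P / c ^+ 4 * (al1 - al2) ^+ 2
  = (2 * (al1 * g1 - al2 * g2) ^+ 2 + 2 * (P / c ^+ 2) * (al1 - al2) ^+ 2) / c ^+ 2.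
  by field; rewrite gt_eqF.
rewrite ler_pdivlMr// mulrC.
apply: (@le_trans _ _ (al1 ^+ 2 * (g1 - g2) ^+ 2)).
  rewrite ler_wpM2r ?sqr_ge0//.
  by rewrite ler_pXn2r ?nnegrE ?(ltW c0)// (le_trans (ltW c0)).
apply: (@le_trans _ _ (2 * (al1 * g1 - al2 * g2) ^+ 2 + 2 * g2 ^+ 2 * (al1 - al2) ^+ 2)).
  rewrite -subr_ge0.
  rewrite (_ : _ - _ = (al1 * g1 - al2 * g2 + (al1 - al2) * g2) ^+ 2) ?sqr_ge0//.
  by ring.
by rewrite lerD2l ler_wpM2r ?sqr_ge0// ler_wpM2l.
Qed.

(** [K] is fixed before the mesh and the functions; it depends only on [a], [b], [c], [M] and the
    integral of [al1 ^+ 2]. *)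
Lemma dpwlin_L2_error_flux (R : realType) (a b c M : R) (al al1 : R -> R) : a < b ->
  0 < c -> {in `]a, b[, forall z, c <= al z} ->
  {within `[a, b], continuous al} -> {in `[a, b], forall z, `|al z| <= M} ->
  {in `]a, b[, forall z, derivable al z 1} ->
  {in `]a, b[, continuous (derive1 al)} ->
  {in `]a, b[, al1 =1 derive1 al} -> measurable_fun `[a, b] al1 ->
  mu.-integrable `[a, b] (EFin \o (fun t => al1 t ^+ 2)) ->
  exists2 K : R, 0 < K & forall (h : R) (N : nat) (u g q : R -> R),
    0 < h -> (0 < N)%N -> b = a + N%:R * h ->
    {within `[a, b], continuous u} -> {within `[a, b], continuous g} ->
    real_weak_derivative a b u g ->
    real_weak_derivative a b (fun z => al z * g z) q ->
    measurable_fun `[a, b] q ->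
    mu.-integrable `[a, b] (EFin \o (fun t => q t ^+ 2)) ->
    (\int[mu]_(z in `[a, b]) ((dpwlin a h N (fun j => u (a + j%:R * h)%R) z - g z) ^+ 2)%:E
    <= (h ^+ 2)%:E * (K%:E * (\int[mu]_(z in `[a, b]) (g z ^+ 2)%:E +
                              \int[mu]_(z in `[a, b]) (q z ^+ 2)%:E)))%E.
Proof.
move=> ab c0 cal calc alM dal cal1 al1E mal1 ial1.
have L0 : 0 < b - a by rewrite subr_gt0.
set A := \int[mu]_(t in `[a, b]) al1 t ^+ 2.
have A0 : 0 <= A by apply: Rintegral_ge0 => t _; exact: sqr_ge0.
pose k1 := 2 / c ^+ 2.
pose k2 := 2 / c ^+ 4.
have k10 : 0 < k1 by rewrite divr_gt0// exprn_gt0.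
have k20 : 0 < k2 by rewrite divr_gt0// exprn_gt0.
(* The integral of the density [G] below is [k1 * Q + k2 * P * A], and [P] has coefficients
   [2 / (b - a) * M ^+ 2] on [Ig] and [2 * (b - a)] on [Q]. Their sum serves both, so that [Ig + Q]
   factors out. *)
pose K := k1 + k2 * A * (2 / (b - a) * M ^+ 2 + 2 * (b - a)).
have K2 : 0 <= k2 * A * (2 / (b - a) * M ^+ 2 + 2 * (b - a)).
  apply: mulr_ge0; first by rewrite mulr_ge0// ltW.
  by do ?[exact: sqr_ge0|exact: (ltW L0)|apply: addr_ge0|apply: mulr_ge0]; rewrite ?invr_ge0 //; exact: (ltW _).
exists K; first by rewrite /K ltr_wpDr.
move=> h N u g q h0 N0 bE cu cg wd wdq mq iq.
have mg : measurable_fun `[a, b] g by exact: subspace_continuous_measurable_fun.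
have cg2 : {within `[a, b], continuous (fun s => g s ^+ 2)}.
  by move=> s; apply: cvgM; exact: cg.
have ig2 := within_continuous_integrable cg2.
have cp : {within `[a, b], continuous (fun z => al z * g z)} by exact: within_continuousM.
have pq := weak_derivative_FTC2 ab cp (sqr_integrable mq iq) wdq.
have alal1 := derive_FTC2 ab calc (sqr_integrable mal1 ial1) dal cal1 al1E.
set Ig := \int[mu]_(z in `[a, b]) g z ^+ 2.
set Q := \int[mu]_(z in `[a, b]) q z ^+ 2.
have Ig0 : 0 <= Ig by apply: Rintegral_ge0 => t _; exact: sqr_ge0.
have Q0 : 0 <= Q by apply: Rintegral_ge0 => t _; exact: sqr_ge0.
(* A uniform bound on the square of the flux [al * g]: [sqr_sup_le] with [|al| <= M] inserted. *)
pose P := 2 / (b - a) * (M ^+ 2 * Ig) + 2 * (b - a) * Q.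
have P0 : 0 <= P.
  by do ?[exact: sqr_ge0|exact: (ltW L0)|apply: addr_ge0|apply: mulr_ge0]; rewrite ?invr_ge0 //; exact: (ltW _).
have pP t : t \in `[a, b] -> (al t * g t) ^+ 2 <= P.
  move=> tab; apply: le_trans (sqr_sup_le ab cp mq iq pq tab) _.
  rewrite /P lerD2r ler_wpM2l//; first by rewrite mulr_ge0 ?invr_ge0 ?(ltW L0).
  rewrite -RintegralZl//; apply: le_Rintegral => //.
  - by apply: within_continuous_integrable => s; apply: cvgM; exact: cp.
  - exact: (integrableZl _ (M ^+ 2) ig2).
  - move=> s sab; rewrite exprMn ler_wpM2r ?sqr_ge0//.
    rewrite -[leLHS]real_normK ?num_real// ler_pXn2r ?nnegrE//; first exact: alM.
    by apply: le_trans (alM s sab).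
(* The two terms of [sqr_quotientB_le]: the oscillation of the flux is paid for by [q], that of [al]
   by [al1]. *)
pose G t := k1 * q t ^+ 2 + k2 * P * al1 t ^+ 2.
have iG1 : mu.-integrable `[a, b] (EFin \o (fun t => k1 * q t ^+ 2)).
  exact: (integrableZl _ k1 iq).
have iG2 : mu.-integrable `[a, b] (EFin \o (fun t => k2 * P * al1 t ^+ 2)).
  exact: (integrableZl _ (k2 * P) ial1).
have iG : mu.-integrable `[a, b] (EFin \o G).
  rewrite (_ : _ \o _ = ((EFin \o (fun t => k1 * q t ^+ 2)%R) \+
    (EFin \o (fun t => k2 * P * al1 t ^+ 2)%R))%E); last by apply/funext.
  exact: integrableD.
have GE x x' : a <= x -> x' <= b -> \int[mu]_(t in `[x, x']) G t =
    k1 * \int[mu]_(t in `[x, x']) q t ^+ 2 +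
    k2 * P * \int[mu]_(t in `[x, x']) al1 t ^+ 2.
  move=> ax xb.
  have sub : `[x, x'] `<=` `[a, b] by apply: subset_itv; rewrite bnd_simp.
  rewrite RintegralD//; [|exact: integrableS iG1|exact: integrableS iG2].
  by rewrite !RintegralZl//; [exact: integrableS ial1|exact: integrableS iq].
have := @dpwlin_L2_error _ a b h N u g G h0 N0 bE cu mg (sqr_integrable mg ig2) wd _ iG _
  (@measurable_dpwlin _ _ _ _ _ _).
move=> /(_ _ _)/le_trans; apply.
- by move=> t; do ?[exact: sqr_ge0|exact: (ltW k10)|exact: (ltW k20)|exact: P0|apply: addr_ge0|apply: mulr_ge0].
- move=> x x' y z ax xb yx zx.
  have sub : `]x, x'[ `<=` `]a, b[ by apply: subset_itv; rewrite bnd_simp.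
  have yc := subset_itv_oo_cc yx; have zc := subset_itv_oo_cc zx.
  have zab : z \in `[a, b] by apply: subset_itv_oo_cc; exact: sub.
  apply: le_trans (sqr_quotientB_le _ c0 (cal _ (sub _ yx)) (cal _ (sub _ zx)) (pP _ zab)) _.
  rewrite GE// [leRHS]mulrDr; apply: lerD.
    rewrite [leRHS]mulrCA -/k1 ler_wpM2l ?(ltW k10)//.
    exact: (FTC2_oscillation mq iq pq).
  rewrite [leRHS]mulrCA (_ : 2 * P / c ^+ 4 = k2 * P); last by rewrite /k2; ring.
  rewrite ler_wpM2l ?(mulr_ge0 (ltW k20))//.
  exact: (FTC2_oscillation mal1 ial1 alal1).
have EfinI (f : R -> R) : mu.-integrable `[a, b] (EFin \o f) ->
    (\int[mu]_(z in `[a, b]) (f z)%:E)%E = (\int[mu]_(z in `[a, b]) f z)%:E.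
  by move=> if_; rewrite /Rintegral fineK//; exact: integrable_fin_num.
rewrite !EfinI// GE// -/Q -/A -/Ig -EFinD -!EFinM lee_fin ler_wpM2l ?sqr_ge0//.
rewrite -subr_ge0.
rewrite (_ : _ - _ = k1 * Ig + k2 * A * (2 / (b - a) * M ^+ 2 * Q + 2 * (b - a) * Ig)).
  do ?[exact: sqr_ge0|exact: (ltW L0)|exact: (ltW k10)|exact: (ltW k20)|apply: addr_ge0|apply: mulr_ge0] => //.
  by rewrite invr_ge0 ltW.
by rewrite /K /P; ring.
Qed.

(** * Weighted estimates for complex-valued functions *)

Lemma itvoo_bigcup_itvcc (R : realType) (a b : R) :
  [set` `]a, b[] = \bigcup_n [set` `[a + n.+1%:R^-1, b - n.+1%:R^-1]].
Proof.
apply/seteqP; split=> [x /= xab|x [n _] /=]; last first.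
  have n0 : 0 < n.+1%:R^-1 :> R by rewrite invr_gt0.
  rewrite !in_itv/=; move: (n.+1%:R^-1) n0 => e e0 /andP[? ?].
  by apply/andP; split; lra.
have m0 : 0 < Num.min (x - a) (b - x) by rewrite lt_min !subr_gt0 !(itvP xab).
have [n _ /(_ n (leqnn n))/= nx] := near_infty_natSinv_lt (PosNum m0).
exists n => //=; rewrite in_itv/=; move: nx.
rewrite lt_min; by move: (n.+1%:R^-1) => e /andP[? ?]; apply/andP; split; lra.
Qed.

Lemma measurable_fun_itvoo_itvcc (R : realType) (a b : R) (f : R -> R) :
  measurable_fun `]a, b[ f -> measurable_fun `[a, b] f.
Proof.
by move=> mf; apply/measurable_fun_itv_bndo_bndcP/measurable_fun_itv_obnd_cbndP.
Qed.

(** Integrability is given on compact subintervals; measurability passes to their countable union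
    and then to the two end points. *)
Lemma real_weak_derivative_measurable (R : realType) (a b : R) (u g : R -> R) :
  real_weak_derivative a b u g -> measurable_fun `[a, b] g.
Proof.
move=> [ug _]; apply: measurable_fun_itvoo_itvcc.
rewrite itvoo_bigcup_itvcc; apply/measurable_fun_bigcup => // n.
have n0 : 0 < n.+1%:R^-1 :> R by rewrite invr_gt0.
have [] := ug (a + n.+1%:R^-1) (b - n.+1%:R^-1); rewrite ?ltrDl ?gtrBl//.
by move=> _ /integrableP[/measurable_EFinP].
Qed.

(** Allows the flux built from a chosen weak derivative to be replaced by its continuous version. *)
Lemma real_weak_derivative_ae (R : realType) (a b : R) (u u' g : R -> R) :
  real_weak_derivative a b u g ->
  (forall c d, a < c -> d < b -> mu.-integrable `[c, d] (EFin \o u')) ->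
  {ae mu, forall x, x \in `]a, b[ -> u x = u' x} ->
  real_weak_derivative a b u' g.
Proof.
move=> [ug wd] iu' uu'; split=> [c d ac db|psi c d ac db dpsi cpsi psi0].
  by split; [exact: iu'|have [] := ug c d ac db].
have cdab : `[c, d] `<=` `]a, b[ by apply: subset_itvSoo; rewrite bnd_simp.
have [iu ig] := ug c d ac db.
rewrite -(wd psi c d)//.
have psi'0 := derive1_out psi0.
rewrite !(@Rintegral_subset0 _ `[c, d] `]a, b[)//; try by move=> x _ /negP/psi'0 ->; rewrite mulr0.
have mpsi : measurable_fun `[c, d] (derive1 psi).
  by apply: measurable_funTS; exact: continuous_measurable_fun.
have mf f : mu.-integrable `[c, d] (EFin \o f) ->
    measurable_fun `[c, d] (fun x => (f x * derive1 psi x)%:E).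
  move=> /integrableP[/measurable_EFinP mf _].
  by apply/measurable_EFinP; exact: measurable_funM.
rewrite /Rintegral; congr fine; apply: ae_eq_integral => //.
- by apply: mf; exact: iu'.
- exact: mf.
move: uu'; apply: filterS; first exact: (ae_filter_ringOfSetsType mu).
by move=> x + /cdab xab => /(_ xab) ->.
Qed.

(** Norms integrate over closed edges while the weights are controlled only at interior points; the
    end points are negligible. *)
Lemma integral_itvcc_le (R : realType) (a b : R) (f1 f2 : R -> R) :
  measurable_fun `[a, b] f1 -> measurable_fun `[a, b] f2 ->
  (forall z, z \in `]a, b[ -> 0 <= f1 z <= f2 z) ->
  (\int[mu]_(z in `[a, b]) (f1 z)%:E <= \int[mu]_(z in `[a, b]) (f2 z)%:E)%E.
Proof.
move=> mf1 mf2 f12.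
have sub : `]a, b[ `<=` `[a, b] by exact: subset_itv_oo_cc.
have m1 : measurable_fun `]a, b[ f1 by exact: measurable_funS mf1.
have m2 : measurable_fun `]a, b[ f2 by exact: measurable_funS mf2.
rewrite [leLHS]integral_itv_bndoo; last exact/measurable_EFinP.
rewrite [leRHS]integral_itv_bndoo; last exact/measurable_EFinP.
apply: ge0_le_integral => //.
- by move=> z /f12/andP[f10 _]; rewrite lee_fin.
- exact/measurable_EFinP.
- exact/measurable_EFinP.
- by move=> z /f12/andP[_]; rewrite lee_fin.
Qed.

Lemma integral_itvcc_ae (R : realType) (a b : R) (f1 f2 : R -> R) :
  measurable_fun `[a, b] f1 -> measurable_fun `[a, b] f2 ->
  {ae mu, forall z, z \in `]a, b[ -> f1 z = f2 z} ->
  (\int[mu]_(z in `[a, b]) (f1 z)%:E = \int[mu]_(z in `[a, b]) (f2 z)%:E)%E.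
Proof.
move=> mf1 mf2 f12.
have sub : `]a, b[ `<=` `[a, b] by exact: subset_itv_oo_cc.
have m1 : measurable_fun `]a, b[ f1 by exact: measurable_funS mf1.
have m2 : measurable_fun `]a, b[ f2 by exact: measurable_funS mf2.
rewrite [LHS]integral_itv_bndoo; last exact/measurable_EFinP.
rewrite [RHS]integral_itv_bndoo; last exact/measurable_EFinP.
apply: ae_eq_integral => //; [exact/measurable_EFinP..|].
move: f12; apply: filterS; first exact: (ae_filter_ringOfSetsType mu).
by move=> x /= f12x /f12x ->.
Qed.

Lemma integral_weight_le (R : realType) (a b k : R) (F W : R -> R) : 0 <= k ->
  measurable_fun `[a, b] F -> measurable_fun `[a, b] W -> (forall z, 0 <= F z) ->
  (forall z, z \in `]a, b[ -> 0 <= W z <= k) ->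
  (\int[mu]_(z in `[a, b]) (F z * W z)%:E <=
   k%:E * \int[mu]_(z in `[a, b]) (F z)%:E)%E.
Proof.
move=> k0 mF mW F0 Wk.
rewrite -ge0_integralZl_EFin//; [|by move=> z _; rewrite lee_fin|exact/measurable_EFinP].
apply: integral_itvcc_le; [exact: measurable_funM|exact: measurable_funM|].
by move=> z /Wk/andP[W0 Wzk]; rewrite mulr_ge0//= mulrC ler_wpM2r.
Qed.

Lemma integral_weight_ge (R : realType) (a b k : R) (F W : R -> R) : 0 < k ->
  measurable_fun `[a, b] F -> measurable_fun `[a, b] W -> (forall z, 0 <= F z) ->
  (forall z, z \in `]a, b[ -> k <= W z) ->
  (\int[mu]_(z in `[a, b]) (F z)%:E <=
   k^-1%:E * \int[mu]_(z in `[a, b]) (F z * W z)%:E)%E.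
Proof.
move=> k0 mF mW F0 kW.
have sub : `]a, b[ `<=` `[a, b] by exact: subset_itv_oo_cc.
have mFW : measurable_fun `[a, b] (fun z => F z * W z) by exact: measurable_funM.
rewrite [X in (_ <= _ * X)%E]integral_itv_bndoo; last first.
  by apply/measurable_EFinP; exact: measurable_funS mFW.
rewrite -ge0_integralZl_EFin ?invr_ge0 ?(ltW k0)//; last 2 first.
- move=> z /kW kWz; rewrite lee_fin mulr_ge0//; exact: le_trans (ltW k0) _.
- by apply/measurable_EFinP; exact: measurable_funS mFW.
rewrite integral_itv_bndoo; last by apply/measurable_EFinP; exact: measurable_funS mF.
apply: ge0_le_integral => //.
- by move=> z _; rewrite lee_fin.
- by apply/measurable_EFinP; exact: measurable_funS mF.
- apply/measurable_EFinP; apply: measurable_funM => //; exact: measurable_funS mFW.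
- move=> z /kW kWz; rewrite lee_fin ler_pdivlMl// mulrC ler_wpM2l//.
Qed.

Notation cRe := (complex.Re (R := _)).
Notation cIm := (complex.Im (R := _)).

(** The squared modulus as a real number, convertible with the expression inside [L2norm2]. *)
Definition sqrc (R : realType) (x : R[i]) : R := cRe x ^+ 2 + cIm x ^+ 2.

Lemma sqrc_ge0 (R : realType) (x : R[i]) : 0 <= sqrc x.
Proof. by rewrite addr_ge0 ?sqr_ge0. Qed.

Lemma sqrcZ (R : realType) (k : R) (x : R[i]) : sqrc (k%:C%C * x) = k ^+ 2 * sqrc x.
Proof. by case: x => x y; rewrite /sqrc /=; ring. Qed.

Lemma ReB (R : realType) (x y : R[i]) : cRe (x - y) = cRe x - cRe y.
Proof. by case: x; case: y. Qed.

Lemma ImB (R : realType) (x y : R[i]) : cIm (x - y) = cIm x - cIm y.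
Proof. by case: x; case: y. Qed.

Lemma ReZ (R : realType) (k : R) (x : R[i]) : cRe (k%:C%C * x) = k * cRe x.
Proof. by case: x => x y /=; rewrite mul0r subr0. Qed.

Lemma ImZ (R : realType) (k : R) (x : R[i]) : cIm (k%:C%C * x) = k * cIm x.
Proof. by case: x => x y /=; rewrite mul0r addr0. Qed.

Definition cmeasurable (R : realType) (D : set R) (w : R -> R[i]) : Prop :=
  measurable_fun D (cRe \o w) /\ measurable_fun D (cIm \o w).

Lemma measurable_sqrc (R : realType) (D : set R) (w : R -> R[i]) :
  cmeasurable D w -> measurable_fun D (fun z => sqrc (w z)).
Proof. by move=> [mr mi]; apply: measurable_funD; exact: measurable_funX. Qed.

Lemma ccontinuous_cmeasurable (R : realType) (a b : R) (w : R -> R[i]) :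
  ccontinuous_on `[a, b] w -> cmeasurable `[a, b] w.
Proof.
by move=> [cr ci]; split; apply: subspace_continuous_measurable_fun => //;
  exact: measurable_itv.
Qed.

Lemma weak_derivative_cmeasurable (R : realType) (a b : R) (w g : R -> R[i]) :
  weak_derivative a b w g -> cmeasurable `[a, b] g.
Proof.
by move=> [/real_weak_derivative_measurable mr /real_weak_derivative_measurable mi].
Qed.

Lemma integral_sqrc (R : realType) (a b : R) (w : R -> R[i]) : cmeasurable `[a, b] w ->
  (\int[mu]_(z in `[a, b]) (sqrc (w z))%:E =
   \int[mu]_(z in `[a, b]) (cRe (w z) ^+ 2)%:E +
   \int[mu]_(z in `[a, b]) (cIm (w z) ^+ 2)%:E)%E.
Proof.
move=> [mr mi]; rewrite -ge0_integralD//.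
- by move=> z _; rewrite lee_fin sqr_ge0.
- by apply/measurable_EFinP; exact: measurable_funX mr.
- by move=> z _; rewrite lee_fin sqr_ge0.
- by apply/measurable_EFinP; exact: measurable_funX mi.
Qed.

Lemma sqrc_integrable (R : realType) (a b : R) (w : R -> R[i]) : cmeasurable `[a, b] w ->
  (\int[mu]_(z in `[a, b]) (sqrc (w z))%:E < +oo)%E ->
  mu.-integrable `[a, b] (EFin \o (fun z => cRe (w z) ^+ 2)) /\
  mu.-integrable `[a, b] (EFin \o (fun z => cIm (w z) ^+ 2)).
Proof.
move=> mw; rewrite integral_sqrc// => ltw; have [mr mi] := mw.
have ge0 (f : R -> R) : (0 <= \int[mu]_(z in `[a, b]) (f z ^+ 2)%:E)%E.
  by apply: integral_ge0 => z _; rewrite lee_fin sqr_ge0.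
have intf (f : R -> R) : measurable_fun `[a, b] f ->
    (\int[mu]_(z in `[a, b]) (f z ^+ 2)%:E < +oo)%E ->
    mu.-integrable `[a, b] (EFin \o (fun z => f z ^+ 2)).
  move=> mf lf; apply/integrableP; split.
    by apply/measurable_EFinP; exact: measurable_funX.
  under eq_integral => z _ do rewrite /= ger0_norm ?sqr_ge0//.
  exact: lf.
split; apply: intf => //; apply: le_lt_trans ltw.
  by rewrite leeDl.
by rewrite leeDr.
Qed.

Definition cpwlin (R : realType) (a h : R) (N : nat) (c : nat -> R[i]) (z : R) : R[i] :=
  Complex (pwlin a h N (cRe \o c) z) (pwlin a h N (cIm \o c) z).

Definition cdpwlin (R : realType) (a h : R) (N : nat) (c : nat -> R[i]) (z : R) : R[i] :=
  Complex (dpwlin a h N (cRe \o c) z) (dpwlin a h N (cIm \o c) z).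

Lemma ccontinuous_cpwlin (R : realType) (I : interval R) (a h : R) (N : nat) (c : nat -> R[i]) :
  0 < h -> ccontinuous_on I (cpwlin a h N c).
Proof. by move=> h0; split; apply: continuous_subspaceT; exact: continuous_pwlin. Qed.

Lemma ccontinuousB (R : realType) (I : interval R) (v w : R -> R[i]) :
  ccontinuous_on I v -> ccontinuous_on I w -> ccontinuous_on I (fun z => v z - w z).
Proof.
move=> [vr vi] [wr wi]; split.
  rewrite (_ : (fun z => _) = (fun z => cRe (v z) - cRe (w z))); last first.
    by apply/funext => z; rewrite ReB.
  by move=> x; apply: cvgB; [exact: vr|exact: wr].
rewrite (_ : (fun z => _) = (fun z => cIm (v z) - cIm (w z))); last first.
  by apply/funext => z; rewrite ImB.
by move=> x; apply: cvgB; [exact: vi|exact: wi].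
Qed.

Lemma weak_derivativeB (R : realType) (a b : R) (v w f g : R -> R[i]) :
  weak_derivative a b v f -> weak_derivative a b w g ->
  weak_derivative a b (fun z => v z - w z) (fun z => f z - g z).
Proof.
move=> [vr vi] [wr wi]; split.
  have := real_weak_derivative_lin (-1) wr vr.
  by congr real_weak_derivative; apply/funext => z; rewrite mulN1r addrC; symmetry; exact: ReB.
have := real_weak_derivative_lin (-1) wi vi.
by congr real_weak_derivative; apply/funext => z; rewrite mulN1r addrC; symmetry; exact: ImB.
Qed.

Lemma weak_derivative_cpwlin (R : realType) (a b x h : R) (N : nat) (c : nat -> R[i]) :
  0 < h -> weak_derivative a b (cpwlin x h N c) (cdpwlin x h N c).
Proof. by move=> h0; split; exact: real_weak_derivative_pwlin. Qed.

Lemma weak_derivative_unique (R : realType) (a b : R) (w f g : R -> R[i]) :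
  weak_derivative a b w f -> weak_derivative a b w g ->
  {ae mu, forall z, z \in `]a, b[ -> f z = g z}.
Proof.
move=> [fr fi] [gr gi].
have := real_weak_derivative_unique fr gr.
have := real_weak_derivative_unique fi gi.
apply: filterS2; first exact: (ae_filter_ringOfSetsType mu).
move=> z fgi fgr zab; have := fgr zab; have := fgi zab.
by rewrite /=; case: (f z) (g z) => ? ? [? ?] /= -> ->.
Qed.

Lemma integral_sqrc_ae (R : realType) (a b : R) (f g : R -> R[i]) :
  cmeasurable `[a, b] f -> cmeasurable `[a, b] g ->
  {ae mu, forall z, z \in `]a, b[ -> f z = g z} ->
  (\int[mu]_(z in `[a, b]) (sqrc (f z))%:E = \int[mu]_(z in `[a, b]) (sqrc (g z))%:E)%E.
Proof.
move=> mf mg fg; apply: integral_itvcc_ae; [exact: measurable_sqrc..|].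
move: fg; apply: filterS; first exact: (ae_filter_ringOfSetsType mu).
by move=> x fgx /fgx ->.
Qed.

Lemma weighted_integrable (R : realType) (a b k : R) (w : R -> R[i]) (W : R -> R) :
  0 < k -> cmeasurable `[a, b] w -> measurable_fun `[a, b] W ->
  (forall z, z \in `]a, b[ -> k <= W z) ->
  (\int[mu]_(z in `[a, b]) (sqrc (w z) * W z)%:E < +oo)%E ->
  (\int[mu]_(z in `[a, b]) (sqrc (w z))%:E < +oo)%E.
Proof.
move=> k0 mw mW kW lw.
have := integral_weight_ge k0 (measurable_sqrc mw) mW (fun z => sqrc_ge0 (w z)) kW.
move/le_lt_trans; apply; apply: lte_mul_pinfty => //.
by rewrite lee_fin invr_ge0 ltW.
Qed.

Lemma weighted_sqrc_integral_ge0 (R : realType) (a b : R) (f : R -> R[i]) (W : R -> R) :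
  cmeasurable `[a, b] f -> measurable_fun `[a, b] W ->
  (forall z, z \in `]a, b[ -> 0 <= W z) ->
  (0 <= \int[mu]_(z in `[a, b]) (sqrc (f z) * W z)%:E)%E.
Proof.
move=> mf mW W0; rewrite integral_itv_bndoo; last first.
  have mfW : measurable_fun `[a, b] (fun z => sqrc (f z) * W z).
    by apply: measurable_funM => //; exact: measurable_sqrc.
  apply/measurable_EFinP; apply: measurable_funS mfW => //; exact: subset_itv_oo_cc.
by apply: integral_ge0 => z /W0 ?; rewrite lee_fin mulr_ge0// sqrc_ge0.
Qed.

(** * Interpolation errors with weights on one edge *)

Lemma lee_wpmul2l_trans (R : realType) (k : R) (x y z : \bar R) : 0 <= k ->
  (x <= k%:E * y -> y <= z -> x <= k%:E * z)%E.
Proof. by move=> k0 xy yz; rewrite (le_trans xy)// lee_wpmul2l. Qed.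

(** The factor [n1] removes the weight [nu] from the error, and [s0^-1] restores the weight [sg] on
    [g]. *)
Lemma edge_interp_error (R : realType) (a b s0 n1 : R) (sg nu : R -> R) :
  a < b -> 0 < s0 -> 0 < n1 ->
  measurable_fun `[a, b] sg -> measurable_fun `[a, b] nu ->
  (forall z, z \in `]a, b[ -> s0 <= sg z) ->
  (forall z, z \in `]a, b[ -> 0 <= nu z <= n1) ->
  forall (N : nat) (w g : R -> R[i]), (0 < N)%N ->
  ccontinuous_on `[a, b] w -> weak_derivative a b w g ->
  (\int[mu]_(z in `[a, b]) (sqrc (g z) * sg z)%:E < +oo)%E ->
  (\int[mu]_(z in `[a, b])
     (sqrc (cpwlin a ((b - a) / N%:R)%R N (fun j => w (a + j%:R * ((b - a) / N%:R))%R) z - w z)%R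
       * nu z)%:E
   <= (n1 * (s0^-1 * ((b - a) / N%:R) ^+ 2))%:E *
      \int[mu]_(z in `[a, b]) (sqrc (g z) * sg z)%:E)%E.
Proof.
move=> ab s00 n10 msg mnu sgs nun N w g N0 cw wd lg.
set h := (b - a) / N%:R.
have h0 : 0 < h by rewrite divr_gt0 ?subr_gt0 ?ltr0n.
have bE : b = a + N%:R * h by rewrite mulrC divfK ?pnatr_eq0 -?lt0n//; ring.
have mg := weak_derivative_cmeasurable wd.
have lg1 := weighted_integrable s00 mg msg sgs lg.
have [ir ii] := sqrc_integrable mg lg1.
set err := fun z => cpwlin a h N (fun j => w (a + j%:R * h)) z - w z.
have cerr : ccontinuous_on `[a, b] err by apply: ccontinuousB => //; exact: ccontinuous_cpwlin.
have merr := ccontinuous_cmeasurable cerr.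
have [cwr cwi] := cw; have [wdr wdi] := wd; have [mgr mgi] := mg.
have Er := pwlin_L2_error h0 N0 bE cwr mgr ir wdr.
have Ei := pwlin_L2_error h0 N0 bE cwi mgi ii wdi.
rewrite EFinM -muleA.
apply: (lee_wpmul2l_trans (ltW n10) (integral_weight_le (ltW n10) (measurable_sqrc merr) mnu
  (fun z => sqrc_ge0 (err z)) nun)).
rewrite (mulrC s0^-1) EFinM -muleA.
apply: (@lee_wpmul2l_trans _ _ _ (\int[mu]_(z in `[a, b]) (sqrc (g z))%:E)%E _ (sqr_ge0 h)); last first.
  exact: integral_weight_ge s00 (measurable_sqrc mg) msg (fun z => sqrc_ge0 (g z)) sgs.
rewrite integral_sqrc//.
rewrite integral_sqrc// ge0_muleDr; last 2 first.
- by apply: integral_ge0 => z _; rewrite lee_fin sqr_ge0.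
- by apply: integral_ge0 => z _; rewrite lee_fin sqr_ge0.
apply: leeD.
- by under eq_integral => z _ do rewrite ReB; exact: Er.
- by under eq_integral => z _ do rewrite ImB; exact: Ei.
Qed.

(** The domain condition concerns [al] times some representative [g], perhaps discontinuous. Since
    [g] and [gc] agree almost everywhere, [q] is also a weak derivative of the continuous flux
    [al * gc], to which the fundamental theorem applies. *)
Lemma weak_derivative_flux (R : realType) (a b : R) (al : R -> R) (w g gc q : R -> R[i]) :
  {within `[a, b], continuous al} -> ccontinuous_on `[a, b] gc ->
  weak_derivative a b w g -> weak_derivative a b w gc ->
  weak_derivative a b (fun z => (al z)%:C%C * g z) q ->
  real_weak_derivative a b (fun z => al z * cRe (gc z)) (cRe \o q) /\
  real_weak_derivative a b (fun z => al z * cIm (gc z)) (cIm \o q).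
Proof.
move=> cal [cr ci] wg wgc [wqr wqi].
have gE := weak_derivative_unique wg wgc.
have int (f : R -> R) : {within `[a, b], continuous f} -> forall c d, a < c -> d < b ->
    mu.-integrable `[c, d] (EFin \o (fun z => al z * f z)).
  move=> cf c d ac db.
  have := within_continuous_integrable (within_continuousM cal cf).
  apply: integrableS => //.
  by apply: subset_itv; rewrite bnd_simp ltW.
split.
- apply: real_weak_derivative_ae wqr _ _; first exact: int.
  move: gE; apply: filterS; first exact: (ae_filter_ringOfSetsType mu).
  by move=> z /[apply] <-; exact: ReZ.
- apply: real_weak_derivative_ae wqi _ _; first exact: int.
  move: gE; apply: filterS; first exact: (ae_filter_ringOfSetsType mu).
  by move=> z /[apply] <-; exact: ImZ.
Qed.

(** [g], [q] and [gerr] are arbitrary representatives that enter through integrals; the pointwise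
    argument runs on the continuous [gc]. *)
Lemma edge_interp_deriv_error (R : realType) (a b c M s0 s1 n0 c4 : R)
    (al al1 sg nu be : R -> R) :
  a < b -> 0 < c -> {in `]a, b[, forall z, c <= al z} ->
  {within `[a, b], continuous al} -> {in `[a, b], forall z, `|al z| <= M} ->
  {in `]a, b[, forall z, derivable al z 1} ->
  {in `]a, b[, continuous (derive1 al)} ->
  {in `]a, b[, al1 =1 derive1 al} -> measurable_fun `[a, b] al1 ->
  mu.-integrable `[a, b] (EFin \o (fun t => al1 t ^+ 2)) ->
  0 < s0 -> 0 < s1 -> 0 < n0 -> 0 < c4 ->
  measurable_fun `[a, b] sg -> measurable_fun `[a, b] nu ->
  (forall z, z \in `]a, b[ -> s0 <= sg z <= s1) ->
  (forall z, z \in `]a, b[ -> n0 <= nu z) ->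
  (forall z, z \in `]a, b[ -> 0 < be z <= c4) ->
  exists2 C : R, 0 < C & forall (N : nat) (w g gc q gerr : R -> R[i]), (0 < N)%N ->
    ccontinuous_on `[a, b] w -> weak_derivative a b w g ->
    ccontinuous_on `[a, b] gc -> weak_derivative a b w gc ->
    weak_derivative a b (fun z => (al z)%:C%C * g z) q ->
    cmeasurable `[a, b] (fun z => ((2 * be z)^-1)%:C%C * q z) ->
    (\int[mu]_(z in `[a, b]) (sqrc (g z) * sg z)%:E < +oo)%E ->
    (\int[mu]_(z in `[a, b]) (sqrc (((2 * be z)^-1)%:C%C * q z)%R * nu z)%:E < +oo)%E ->
    weak_derivative a b
      (fun z => cpwlin a ((b - a) / N%:R) N (fun j => w (a + j%:R * ((b - a) / N%:R))) z - w z)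
      gerr ->
    (\int[mu]_(z in `[a, b]) (sqrc (gerr z) * sg z)%:E <=
     (C * ((b - a) / N%:R) ^+ 2)%:E *
     (\int[mu]_(z in `[a, b]) (sqrc (g z) * sg z)%:E +
      \int[mu]_(z in `[a, b]) (sqrc (((2 * be z)^-1)%:C%C * q z)%R * nu z)%:E))%E.
Proof.
move=> ab c0 cal calc alM dal cal1 al1E mal1 ial1 s00 s10 n00 c40 msg mnu sgs nun bec.
have [K K0 HK] := dpwlin_L2_error_flux ab c0 cal calc alM dal cal1 al1E mal1 ial1.
(* From [q = 2 * be * L] with [be <= c4]; [n0^-1] restores the weight [nu]. *)
pose k3 := (2 * c4) ^+ 2 * n0^-1.
have k30 : 0 < k3 by rewrite mulr_gt0 ?invr_gt0// exprn_gt0// mulr_gt0.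
have m0 : 0 < s0^-1 + k3 by rewrite addr_gt0// invr_gt0.
(* [s1] removes the weight from the error, [K] is the unweighted constant, and [s0^-1], [k3] bound
   the unweighted integrals of [g] and [q] by weighted ones. *)
exists (s1 * (K * (s0^-1 + k3))); first by rewrite !mulr_gt0.
move=> N w g gc q gerr N0 cw wg cgc wgc wq mL lg lL wgerr.
set h := (b - a) / N%:R in wgerr *.
have h0 : 0 < h by rewrite divr_gt0 ?subr_gt0 ?ltr0n.
have bE : b = a + N%:R * h by rewrite mulrC divfK ?pnatr_eq0 -?lt0n//; ring.
have mg := weak_derivative_cmeasurable wg.
have mq := weak_derivative_cmeasurable wq.
have mgc := ccontinuous_cmeasurable cgc.
have mgerr := weak_derivative_cmeasurable wgerr.
set L := fun z => ((2 * be z)^-1)%:C%C * q z in mL lL *.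
have qL : (\int[mu]_(z in `[a, b]) (sqrc (q z))%:E <=
    k3%:E * \int[mu]_(z in `[a, b]) (sqrc (L z) * nu z)%:E)%E.
  rewrite EFinM -muleA.
  apply: (@lee_wpmul2l_trans _ _ _ (\int[mu]_(z in `[a, b]) (sqrc (L z))%:E)%E _ (sqr_ge0 (2 * c4))); last first.
    exact: integral_weight_ge n00 (measurable_sqrc mL) mnu (fun z => sqrc_ge0 (L z)) nun.
  rewrite -ge0_integralZl_EFin ?sqr_ge0//; last 2 first.
  - by move=> z _; rewrite lee_fin sqrc_ge0.
  - by apply/measurable_EFinP; exact: measurable_sqrc.
  apply: integral_itvcc_le.
  - exact: measurable_sqrc.
  - by apply: measurable_funM => //; exact: measurable_sqrc.
  move=> z /bec/andP[b0 bc4]; rewrite sqrc_ge0/=.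
  rewrite /L sqrcZ mulrA exprVn ler_peMl ?sqrc_ge0// ler_pdivlMr ?exprn_gt0 ?mulr_gt0// mul1r.
  by rewrite ler_pXn2r ?nnegrE ?mulr_ge0 ?(ltW b0) ?(ltW c40)// ler_pM2l.
have lq : (\int[mu]_(z in `[a, b]) (sqrc (q z))%:E < +oo)%E.
  by apply: le_lt_trans qL _; apply: lte_mul_pinfty; rewrite ?lee_fin ?(ltW k30).
have [iqr iqi] := sqrc_integrable mq lq.
have [wqr wqi] := weak_derivative_flux calc cgc wg wgc wq.
have [cwr cwi] := cw; have [cgr cgi] := cgc; have [wgr wgi] := wgc; have [mqr mqi] := mq.
have Er := HK h N _ _ _ h0 N0 bE cwr cgr wgr wqr mqr iqr.
have Ei := HK h N _ _ _ h0 N0 bE cwi cgi wgi wqi mqi iqi.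
(* [D - gc] is the weak derivative of the error with known values; [gerr] equals it almost
   everywhere. *)
set D := cdpwlin a h N (fun j => w (a + j%:R * h)).
have wD : weak_derivative a b
    (fun z => cpwlin a h N (fun j => w (a + j%:R * h)) z - w z) (fun z => D z - gc z).
  by apply: weak_derivativeB => //; exact: weak_derivative_cpwlin.
have mD := weak_derivative_cmeasurable wD.
have gerrE : (\int[mu]_(z in `[a, b]) (sqrc (gerr z))%:E =
              \int[mu]_(z in `[a, b]) (sqrc (D z - gc z))%:E)%E.
  by apply: integral_sqrc_ae => //; exact: weak_derivative_unique wgerr wD.
have gcE : (\int[mu]_(z in `[a, b]) (sqrc (gc z))%:E =
              \int[mu]_(z in `[a, b]) (sqrc (g z))%:E)%E.
  by apply: integral_sqrc_ae => //; exact: weak_derivative_unique wgc wg.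
have sgb z : z \in `]a, b[ -> 0 <= sg z <= s1.
  by move=> /sgs/andP[/(le_trans (ltW s00)) -> ->].
have sgb0 z : z \in `]a, b[ -> s0 <= sg z by move=> /sgs/andP[].
rewrite -(mulrA s1) EFinM -muleA.
apply: (lee_wpmul2l_trans (ltW s10) (integral_weight_le (ltW s10) (measurable_sqrc mgerr) msg
  (fun z => sqrc_ge0 (gerr z)) sgb)).
rewrite gerrE mulrC EFinM -muleA.
apply: (@lee_wpmul2l_trans _ _ _ (K%:E * (\int[mu]_(z in `[a, b]) (sqrc (g z))%:E +
   \int[mu]_(z in `[a, b]) (sqrc (q z))%:E))%E _ (sqr_ge0 h)).
  have i0 (f : R -> R) : (0 <= \int[mu]_(z in `[a, b]) (f z ^+ 2)%:E)%E.
    by apply: integral_ge0 => z _; rewrite lee_fin sqr_ge0.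
  rewrite -gcE !integral_sqrc// addeACA ge0_muleDr; [|exact: adde_ge0 (i0 _) (i0 _)..].
  rewrite [leRHS]ge0_muleDr; last 2 first.
  - by rewrite mule_ge0 ?lee_fin ?(ltW K0)//; exact: adde_ge0 (i0 _) (i0 _).
  - by rewrite mule_ge0 ?lee_fin ?(ltW K0)//; exact: adde_ge0 (i0 _) (i0 _).
  apply: leeD.
  - by under eq_integral => z _ do rewrite ReB; exact: Er.
  - by under eq_integral => z _ do rewrite ImB; exact: Ei.
rewrite EFinM -muleA; apply: lee_wpmul2l; first by rewrite lee_fin ltW.
set X := (\int[mu]_(z in _) (sqrc (g z) * sg z)%:E)%E.
set Y := (\int[mu]_(z in _) (sqrc (L z) * nu z)%:E)%E.
have X0 : (0 <= X)%E by apply: weighted_sqrc_integral_ge0 => // z /sgb/andP[].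
have Y0 : (0 <= Y)%E by apply: weighted_sqrc_integral_ge0 => // z /nun; exact: le_trans (ltW n00).
have gX : (\int[mu]_(z in `[a, b]) (sqrc (g z))%:E <= s0^-1%:E * X)%E.
  exact: integral_weight_ge s00 (measurable_sqrc mg) msg (fun z => sqrc_ge0 (g z)) sgb0.
apply: (@le_trans _ _ (s0^-1%:E * X + k3%:E * Y)%E); first exact: leeD.
rewrite (ge0_muleDr _ X0 Y0); apply: leeD.
  by rewrite lee_wpmul2r// lee_fin lerDl ltW.
by rewrite lee_wpmul2r// lee_fin lerDr invr_ge0 ltW.
Qed.

(** * Estimates on the graph *)

(** A bounded edge contains a point, at which the value of [H] lies strictly between the end values;
    the truncated unbounded edge runs from [H0] to [r + 1]. *)
Lemma edge_lt (R : realType) (G : hgraph R) (r : R) :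
  is_level_graph G -> H0 G < r -> forall k : 'I_(ge G).+1, ja k < jb r k.
Proof.
move=> [edgeE _ _ Hedge [upE jam _ _]] hr k.
rewrite /jb /vcoord; case E : (up k) => [i|]; last first.
  have := upE k; rewrite E eqxx => /esym/eqP ->.
  by rewrite jam ltr_pwDr// ltW.
have [p pr pE] := edgeE k.
have : (@ham R G @` edge k) (ham G p).
  by exists p => //; rewrite pE; exact: connected_component_refl.
rewrite Hedge /I_int E /= in_itv/= => /andP[]; exact: lt_trans.
Qed.

Lemma itvJ_subset_Icl (R : realType) (G : hgraph R) (r : R) (k : 'I_(ge G).+1) :
  [set` J r k] `<=` [set` I_cl k].
Proof.
rewrite /J /I_cl /jb /vcoord; case: (up k) => [i|]//.
by apply: subset_itvl; rewrite bnd_simp.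
Qed.

Lemma sum_optionD2 (V : nmodType) (I : finType) (i : I) (v : option I) (F : option I -> V) :
  v != Some i -> (forall u, u != Some i -> u != v -> F u = 0) ->
  \sum_u F u = F (Some i) + F v.
Proof.
move=> vi F0; rewrite (bigD1 (Some i))//= (bigD1 v)//= big1 ?addr0//.
by move=> u /andP[]; exact: F0.
Qed.

(** On the edge [k] only its own nodes and its two end vertices contribute; the vertices become the
    terms [j = 0] and [j = N k]. *)
Lemma interp_edge_sum (R : realType) (G : hgraph R) (r : R) (N : 'I_(ge G).+1 -> nat)
    (phi : 'I_(ge G).+1 -> R -> R[i]) (k : 'I_(ge G).+1) (z : R) :
  ja k < jb r k -> (0 < N k)%N ->
  interp r N phi k z = \sum_(0 <= j < (N k).+1)
    phi k (ja k + j%:R * hk r N k) * (hat (ja k + j%:R * hk r N k) (hk r N k) z)%:C%C.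
Proof.
move=> ab N0; rewrite /interp.
rewrite (bigD1 k)//= [X in _ + X + _]big1 ?addr0; last first.
  move=> l lk; apply: big1 => j _; rewrite /node_hat eq_sym (negbTE lk).
  exact: mulr0.
(* In a loop the two end terms would collapse into one; positive length excludes it. *)
have vlo : up k != Some (lo k).
  apply/eqP => E; move: ab; rewrite /jb E /vcoord /ja ltxx//.
rewrite (sum_optionD2 vlo); last first.
  move=> u ulo uup; rewrite /vertex_hat /incident eq_sym (negbTE ulo) eq_sym (negbTE uup).
  exact: mulr0.
rewrite [RHS]big_ltn// [in RHS]big_nat_recr//= addrCA.
rewrite /vertex_hat /incident !eqxx orbT/= -/(jb r k) -/(ja k).
rewrite mul0r addr0.
have -> : ja k + (N k)%:R * hk r N k = jb r k.
  by rewrite /hk /Jlen mulrC divfK ?pnatr_eq0 -?lt0n// addrC subrK.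
congr (_ + (_ + _)).
by apply: eq_bigr => j _; rewrite /node_hat eqxx.
Qed.

Lemma ReM_real (R : realType) (x : R[i]) (k : R) : cRe (x * k%:C%C) = cRe x * k.
Proof. by case: x => x y /=; rewrite mulr0 subr0. Qed.

Lemma ImM_real (R : realType) (x : R[i]) (k : R) : cIm (x * k%:C%C) = cIm x * k.
Proof. by case: x => x y /=; rewrite mulr0 add0r. Qed.

Lemma ReD (R : realType) (x y : R[i]) : cRe (x + y) = cRe x + cRe y.
Proof. by case: x; case: y. Qed.

Lemma ImD (R : realType) (x y : R[i]) : cIm (x + y) = cIm x + cIm y.
Proof. by case: x; case: y. Qed.

Lemma interp_cpwlin (R : realType) (G : hgraph R) (r : R) (N : 'I_(ge G).+1 -> nat)
    (phi : 'I_(ge G).+1 -> R -> R[i]) (k : 'I_(ge G).+1) :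
  ja k < jb r k -> (0 < N k)%N ->
  interp r N phi k = cpwlin (ja k) ((jb r k - ja k) / (N k)%:R) (N k)
    (fun j => phi k (ja k + j%:R * ((jb r k - ja k) / (N k)%:R))).
Proof.
move=> ab N0; apply/funext => z; rewrite interp_edge_sum// /hk /Jlen.
set h := _ / _; apply/eqP; rewrite eq_complex /cpwlin /pwlin; apply/andP; split.
  rewrite (big_morph (complex.Re (R := R)) (@ReD R) (erefl : complex.Re 0 = 0)).
  by apply/eqP; apply: eq_bigr => j _; rewrite ReM_real.
rewrite (big_morph (complex.Im (R := R)) (@ImD R) (erefl : complex.Im 0 = 0)).
by apply/eqP; apply: eq_bigr => j _; rewrite ImM_real.
Qed.

Lemma wderivP (R : realType) (a b : R) (w : R -> R[i]) :
  (exists g, weak_derivative a b w g) -> weak_derivative a b w (wderiv a b w).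
Proof.
move=> ex; have := @xgetPex _ (fun=> 0) [set g | weak_derivative a b w g] ex.
exact.
Qed.

Lemma sqrteD_le (R : realType) (x y : \bar R) : (0 <= x)%E -> (0 <= y)%E ->
  (sqrte (x + y) <= sqrte x + sqrte y)%E.
Proof.
case: x => [x| |]//; case: y => [y| |]//=; rewrite ?leey// !lee_fin => x0 y0.
rewrite -(@ler_pXn2r _ 2) ?nnegrE ?addr_ge0 ?sqrtr_ge0//.
rewrite sqrrD !sqr_sqrtr ?addr_ge0// addrAC lerDl.
by rewrite mulrn_wge0// mulr_ge0 ?sqrtr_ge0.
Qed.

Lemma sqrte_scale_le (R : realType) (c t : R) (x y : \bar R) :
  0 <= c -> 0 <= t -> (0 <= y)%E -> (x <= (c * t ^+ 2)%:E * y)%E ->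
  (sqrte x <= (Num.sqrt c * t)%:E * sqrte y)%E.
Proof.
move=> c0 t0 y0 xy.
have -> : ((Num.sqrt c * t)%:E * sqrte y = sqrte ((c * t ^+ 2)%:E * y))%E.
  by rewrite sqrteM ?lee_fin ?mulr_ge0 ?sqr_ge0//= sqrtrM// sqrtr_sqr ger0_norm.
by rewrite lee_sqrt// mule_ge0// lee_fin mulr_ge0// sqr_ge0.
Qed.

(** Merges the edges: [c] dominates their constants and [t] their mesh sizes. *)
Lemma sum_edges_le (R : realType) (I : finType) (A B : I -> \bar R) (C h : I -> R) (c t : R) :
  (forall i, 0 <= C i <= c) -> (forall i, 0 <= h i <= t) -> (forall i, 0 <= B i)%E ->
  (forall i, A i <= (C i * h i ^+ 2)%:E * B i)%E ->
  (\sum_i A i <= (c * t ^+ 2)%:E * \sum_i B i)%E.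
Proof.
move=> Cc ht B0 AB; rewrite ge0_sume_distrr//; apply: lee_sum => i _.
rewrite (le_trans (AB i))// lee_wpmul2r// lee_fin.
have /andP[C0 ?] := Cc i; have /andP[h0 ?] := ht i.
by apply: ler_pM => //; [exact: sqr_ge0|rewrite ler_pXn2r ?nnegrE// (le_trans h0)].
Qed.

Lemma sum_term_lty (R : realType) (I : finType) (B : I -> \bar R) (i : I) :
  (forall i, 0 <= B i)%E -> (\sum_i B i < +oo)%E -> (B i < +oo)%E.
Proof.
move=> B0; apply: le_lt_trans; rewrite (bigD1 i)//= leeDl//.
by apply: sume_ge0 => j _.
Qed.

(** Extreme values on the compact edge for [ga] and [|al|]; [be] is handled by [c3] and [c4], as its
    continuity is not given. *)
Lemma coefficient_bounds (R : realType) (a b c1 c3 c4 : R) (al be ga : R -> R) : a < b ->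
  {within `[a, b], continuous al} -> {within `[a, b], continuous ga} ->
  {in `[a, b], forall z, 0 < ga z} -> 0 < c1 -> 0 < c3 ->
  {in `]a, b[, forall z, c1 <= al z} -> {in `]a, b[, forall z, c3 <= be z <= c4} ->
  exists M s0 s1 n0 n1 : R,
  [/\ {in `[a, b], forall z, `|al z| <= M}, [/\ 0 < s0, 0 < s1, 0 < n0 & 0 < n1],
      {in `]a, b[, forall z, s0 <= al z * ga z <= s1}
    & {in `]a, b[, forall z, n0 <= be z * ga z <= n1}].
Proof.
move=> ab cal cga ga0 c10 c30 alc bec.
have oc z : z \in `]a, b[ -> z \in `[a, b] by exact: subset_itv_oo_cc.
have [m mab mP] := EVT_min (ltW ab) cga.
have [m' m'ab m'P] := EVT_max (ltW ab) cga.
have [x xab xP] := @EVT_max _ (fun z => `|al z|) _ _ (ltW ab)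
  (fun z => cvg_norm (cal z)).
have mid : (a + b) / 2 \in `]a, b[ by rewrite in_itv/=; apply/andP; split; lra.
have c40 : 0 < c4.
  by have /andP[c3be bec4] := bec _ mid; exact: lt_le_trans c30 (le_trans c3be bec4).
exists `|al x|, (c1 * ga m), (`|al x| * ga m'), (c3 * ga m), (c4 * ga m'); split.
- by move=> z /xP.
- have alx : 0 < `|al x|.
    apply: lt_le_trans (xP _ (oc _ mid)).
    by rewrite normr_gt0 gt_eqF// (lt_le_trans c10)// alc.
  by split; rewrite mulr_gt0// ga0.
- move=> z zab; have c1al := alc z zab.
  have gz := ltW (ga0 _ (oc _ zab)).
  apply/andP; split; apply: ler_pM => //.
  + exact: ltW.
  + by rewrite ltW// ga0.
  + exact: mP (oc _ zab).
  + exact: le_trans (ltW c10) _.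
  + exact: le_trans (ler_norm _) (xP _ (oc _ zab)).
  + exact: m'P (oc _ zab).
- move=> z zab; have /andP[c3be bec4] := bec z zab.
  have gz := ltW (ga0 _ (oc _ zab)).
  apply/andP; split; apply: ler_pM => //.
  + exact: ltW.
  + by rewrite ltW// ga0.
  + exact: mP (oc _ zab).
  + exact: le_trans (ltW c30) _.
  + exact: m'P (oc _ zab).
Qed.

(** The derivative is set to 0 off the open interval, so that nothing depends on its values at the
    end points; fourth-power integrability then gives square integrability on a bounded interval. *)
Lemma derive1_patch_sqr_integrable (R : realType) (a b : R) (al : R -> R) :
  {in `]a, b[, continuous (derive1 al)} ->
  (\int[mu]_(z in `]a, b[) (`|derive1 al z| ^+ 4)%:E < +oo)%E ->
  measurable_fun `[a, b] (derive1 al \_ `]a, b[) /\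
  mu.-integrable `[a, b] (EFin \o (fun z => ((derive1 al \_ `]a, b[) z) ^+ 2)).
Proof.
move=> cal al4; set al1 := derive1 al \_ `]a, b[.
have al1E z : z \in `]a, b[ -> al1 z = derive1 al z.
  by move=> zab; rewrite /al1 patchE mem_set.
have mal1 : measurable_fun `[a, b] al1.
  apply: measurable_fun_itvoo_itvcc.
  apply: (eq_measurable_fun (derive1 al)).
    by move=> z; rewrite inE => zab; rewrite al1E.
  apply: open_continuous_measurable_fun; first exact: interval_open.
  by move=> z; rewrite inE; exact: cal.
split=> //; apply: sqr_integrable; first exact: measurable_funX.
have m4 : measurable_fun `[a, b] (fun z => (al1 z ^+ 2) ^+ 2).
  by apply: measurable_funX; exact: measurable_funX.
apply/integrableP; split; first exact/measurable_EFinP.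
under eq_integral => z _ do rewrite /= ger0_norm ?sqr_ge0//.
rewrite integral_itv_bndoo; last first.
  by apply/measurable_EFinP; apply: measurable_funS m4 => //; exact: subset_itv_oo_cc.
apply: le_lt_trans al4; apply: ge0_le_integral => //.
- by move=> z _; rewrite lee_fin sqr_ge0.
- by apply/measurable_EFinP; apply: measurable_funS m4 => //; exact: subset_itv_oo_cc.
- apply/measurable_EFinP; apply: measurable_funX; apply: measurableT_comp => //.
  apply: open_continuous_measurable_fun; first exact: interval_open.
  by move=> z; rewrite inE; exact: cal.
- move=> z zab; rewrite lee_fin al1E// -exprM -[in leRHS]normrX ger0_norm//.
  by rewrite (_ : 4%N = (2 * 2)%N)// exprM sqr_ge0.
Qed.

(** One constant, the sum of those of the two estimates, chosen before the mesh and the function. *)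
Lemma edge_error_constant (R : realType) (a b c1 c3 c4 : R) (al be ga : R -> R) : a < b ->
  {within `[a, b], continuous al} -> {within `[a, b], continuous ga} ->
  measurable_fun `[a, b] be ->
  {in `[a, b], forall z, 0 < ga z} -> 0 < c1 -> 0 < c3 ->
  {in `]a, b[, forall z, c1 <= al z} -> {in `]a, b[, forall z, c3 <= be z <= c4} ->
  {in `]a, b[, forall z, derivable al z 1} ->
  {in `]a, b[, continuous (derive1 al)} ->
  (\int[mu]_(z in `]a, b[) (`|derive1 al z| ^+ 4)%:E < +oo)%E ->
  exists2 C : R, 0 < C & forall (N : nat) (w g : R -> R[i]), (0 < N)%N ->
    ccontinuous_on `[a, b] w -> weak_derivative a b w g ->
    (\int[mu]_(z in `[a, b]) (sqrc (g z) * (al z * ga z))%:E < +oo)%E ->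
    let err := fun z : R =>
      cpwlin a ((b - a) / N%:R) N (fun j => w (a + j%:R * ((b - a) / N%:R))) z - w z in
    (\int[mu]_(z in `[a, b]) (sqrc (err z) * (be z * ga z))%:E <=
      (C * ((b - a) / N%:R) ^+ 2)%:E *
      \int[mu]_(z in `[a, b]) (sqrc (g z) * (al z * ga z))%:E)%E /\
    forall gc q gerr : R -> R[i],
      let L := fun z => ((2 * be z)^-1)%:C%C * q z in
      ccontinuous_on `[a, b] gc -> weak_derivative a b w gc ->
      weak_derivative a b (fun z => (al z)%:C%C * g z) q ->
      cmeasurable `[a, b] L ->
      (\int[mu]_(z in `[a, b]) (sqrc (L z) * (be z * ga z))%:E < +oo)%E ->
      weak_derivative a b err gerr ->
      (\int[mu]_(z in `[a, b]) (sqrc (gerr z) * (al z * ga z))%:E <=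
       (C * ((b - a) / N%:R) ^+ 2)%:E *
       (\int[mu]_(z in `[a, b]) (sqrc (g z) * (al z * ga z))%:E +
        \int[mu]_(z in `[a, b]) (sqrc (L z) * (be z * ga z))%:E))%E.
Proof.
move=> ab cal cga mbe ga0 c10 c30 alc bec dal cdal al4.
have [M [s0 [s1 [n0 [n1 [alM [s00 s10 n00 n10] sb nb]]]]]] :=
  coefficient_bounds ab cal cga ga0 c10 c30 alc bec.
have [mal1 ial1] := derive1_patch_sqr_integrable cdal al4.
have mga : measurable_fun `[a, b] ga by exact: subspace_continuous_measurable_fun.
have mal : measurable_fun `[a, b] al by exact: subspace_continuous_measurable_fun.
have msg : measurable_fun `[a, b] (fun z => al z * ga z) by exact: measurable_funM.
have mnu : measurable_fun `[a, b] (fun z => be z * ga z) by exact: measurable_funM.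
have al1E : {in `]a, b[, derive1 al \_ `]a, b[ =1 derive1 al}.
  by move=> z zab; rewrite patchE mem_set.
have sb0 z : z \in `]a, b[ -> s0 <= al z * ga z by move=> /sb/andP[].
have nb0 z : z \in `]a, b[ -> n0 <= be z * ga z by move=> /nb/andP[].
have nb1 z : z \in `]a, b[ -> 0 <= be z * ga z <= n1.
  by move=> /nb/andP[/(le_trans (ltW n00)) -> ->].
have be0 z : z \in `]a, b[ -> 0 < be z <= c4.
  by move=> /bec/andP[/(lt_le_trans c30) -> ->].
have c40 : 0 < c4.
  have mid : (a + b) / 2 \in `]a, b[ by rewrite in_itv/=; apply/andP; split; lra.
  by have /andP[/lt_le_trans] := be0 _ mid; apply.
have [C2 C20 HC2] := edge_interp_deriv_error ab c10 alc cal alM dal cdal al1E mal1 ial1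
  s00 s10 n00 c40 msg mnu sb nb0 be0.
pose C1 := n1 * s0^-1.
have C10 : 0 < C1 by rewrite mulr_gt0 ?invr_gt0.
exists (C1 + C2); first exact: addr_gt0.
move=> N w g N0 cw wg lg err.
have mg := weak_derivative_cmeasurable wg.
have sb00 z : z \in `]a, b[ -> 0 <= al z * ga z by move=> /sb0; exact: le_trans (ltW s00).
have nb00 z : z \in `]a, b[ -> 0 <= be z * ga z by move=> /nb1/andP[].
have X0 := weighted_sqrc_integral_ge0 mg msg sb00.
split.
  apply: le_trans (edge_interp_error ab s00 n10 msg mnu sb0 nb1 N0 cw wg lg) _.
  rewrite lee_wpmul2r// lee_fin mulrA -/C1 ler_wpM2r ?sqr_ge0// lerDl; exact: ltW.
move=> gc q gerr L cgc wgc wq mL lL wgerr.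
have Y0 := weighted_sqrc_integral_ge0 mL mnu nb00.
apply: le_trans (HC2 N w g gc q gerr N0 cw wg cgc wgc wq mL lg lL wgerr) _.
rewrite lee_wpmul2r//; first exact: adde_ge0 X0 Y0.
by rewrite lee_fin ler_wpM2r ?sqr_ge0// lerDr; exact: ltW.
Qed.

Theorem lemma7p3 (R : realType) (G : hgraph R)
    (hH : admissible_hamiltonian G) (hG : is_level_graph G)
    (gam : 'I_(ge G).+1 -> R -> R) (hgam : admissible_weight gam)
    (eta : R -> R -> R) (heta : cutoff G eta)
    (alr : R -> R -> 'I_(ge G).+1 -> R -> R) (ber : R -> 'I_(ge G).+1 -> R -> R)
    (hreg : regularizing_weights eta alr ber)
    (delta0 : R) (hdelta0 : 0 < delta0)
    (hdelta_min : forall r, H0 G < r -> delta0 <= delta_min G r)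
    (hReg : Reg eta alr ber delta0)
    (hReg_gamma : Reg_gamma alr ber delta0 gam)
    (hReg_der : Reg_der alr delta0)
    (r : R) (hr : H0 G < r) (d : R) (hd : 0 < d < delta0) :
  let al := alr r d in
  let be := ber d in
  let sigma := fun k z => al k z * gam k z in
  let nu := fun k z => be k z * gam k z in
  exists2 C : R, 0 < C &
  forall (N : 'I_(ge G).+1 -> nat), (forall k, (0 < N k)%N) ->
  (* kappa bounds the ratio of the mesh sizes of the different edges *)
  forall kappa : R, (forall k, hk r N k <= kappa * mesh_min r N) ->
  forall phi : 'I_(ge G).+1 -> R -> R[i], edge_continuous r phi ->
  let err := fun k z => interp r N phi k z - phi k z in
  let h := mesh_min r N in
    (in_W12 r sigma nu phi ->
       (L2norm r nu err <= (C * kappa * h)%:E * W12norm r sigma nu phi)%E) /\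
    (in_dom r al be gam phi ->
       in_W12 r sigma nu err /\
       (W12norm r sigma nu err <=
          (C * kappa * h)%:E *
            (W12norm r sigma nu phi + L2norm r nu (Lop r al be phi)))%E).

Proof.
move=> al be sigma nu.
have hd' : 0 < d < delta_min G r.
  by case/andP: hd => -> dd; exact: lt_le_trans dd (hdelta_min _ hr).
have ab := edge_lt hG hr.
have [c0 [c2 [c3 [c5 [[c00 c20 c30 c50] hReg']]]]] := hReg.
have [c1 [c4 [c10 c40 bnd]]] := (hReg' r hr).1 d hd.
have [gam0 cgam _ _ _] := hgam.
have mbe k : measurable_fun [set` J r k] (be k) by have [] := hreg r d hr hd' k.
have cal k : {within [set` J r k], continuous (al k)} by have [] := hReg_der r d hr hd k.
have cgamJ k : {within [set` J r k], continuous (gam k)}.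
  exact: continuous_subspaceW (@itvJ_subset_Icl _ _ _ _) (cgam k).
have gamJ0 k : {in J r k, forall z, 0 < gam k z}.
  by move=> z zJ; apply: gam0; exact: itvJ_subset_Icl zJ.
have alc k : {in Jint r k, forall z, c1 <= al k z}.
  move=> z zJ; have [/andP[+ _] _] := bnd k z zJ.
  by rewrite ge_max => /andP[].
have bec k : {in Jint r k, forall z, c3 <= be k z <= c4}.
  move=> z zJ; have [_ /andP[-> +]] := bnd k z zJ.
  by rewrite le_min => /andP[].
have edgeC k : exists C : R, 0 < C /\ forall (N : nat) (w g : R -> R[i]), (0 < N)%N ->
    ccontinuous_on (J r k) w -> weak_derivative (ja k) (jb r k) w g ->
    (\int[mu]_(z in [set` J r k]) (sqrc (g z) * sigma k z)%:E < +oo)%E ->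
    let err := fun z : R => cpwlin (ja k) ((jb r k - ja k) / N%:R) N
      (fun j => w (ja k + j%:R * ((jb r k - ja k) / N%:R))) z - w z in
    (\int[mu]_(z in [set` J r k]) (sqrc (err z) * nu k z)%:E <=
      (C * ((jb r k - ja k) / N%:R) ^+ 2)%:E *
      \int[mu]_(z in [set` J r k]) (sqrc (g z) * sigma k z)%:E)%E /\
    forall gc q gerr : R -> R[i],
      let L := fun z => ((2 * be k z)^-1)%:C%C * q z in
      ccontinuous_on (J r k) gc -> weak_derivative (ja k) (jb r k) w gc ->
      weak_derivative (ja k) (jb r k) (fun z => (al k z)%:C%C * g z) q ->
      cmeasurable [set` J r k] L ->
      (\int[mu]_(z in [set` J r k]) (sqrc (L z) * nu k z)%:E < +oo)%E ->
      weak_derivative (ja k) (jb r k) err gerr ->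
      (\int[mu]_(z in [set` J r k]) (sqrc (gerr z) * sigma k z)%:E <=
       (C * ((jb r k - ja k) / N%:R) ^+ 2)%:E *
       (\int[mu]_(z in [set` J r k]) (sqrc (g z) * sigma k z)%:E +
        \int[mu]_(z in [set` J r k]) (sqrc (L z) * nu k z)%:E))%E.
  have [_ dal cdal al4] := hReg_der r d hr hd k.
  have [C C0 HC] := edge_error_constant (ab k) (cal k) (cgamJ k) (mbe k) (gamJ0 k)
    c10 c30 (alc k) (bec k) dal cdal al4.
  by exists C; split.
have [C HC] := choice edgeC.
(* A sum of positive constants dominates each of them, without taking a maximum. *)
pose Cm := \sum_k C k.
have C0 k : 0 < C k by have [] := HC k.
have CCm k : 0 <= C k <= Cm.
  rewrite (ltW (C0 k))/= /Cm (bigD1 k)//= lerDl sumr_ge0// => l _; exact: ltW (C0 l).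
have Cm0 : 0 < Cm by have /andP[_] := CCm ord0; exact: lt_le_trans.
have msigma k : measurable_fun [set` J r k] (sigma k).
  by apply: measurable_funM; apply: subspace_continuous_measurable_fun => //; exact: measurable_itv.
have mnu k : measurable_fun [set` J r k] (nu k).
  apply: measurable_funM => //.
  by apply: subspace_continuous_measurable_fun => //; exact: measurable_itv.
have Jsub (k : 'I_(ge G).+1) z : z \in Jint r k -> z \in J r k by exact: subset_itv_oo_cc.
have sigma0 k z : z \in `]ja k, jb r k[ -> 0 <= sigma k z.
  by move=> zJ; apply: mulr_ge0; [exact: le_trans (ltW c10) (alc k z zJ)|apply: ltW; exact: gamJ0 k z (Jsub k z zJ)].
have nu0 k z : z \in `]ja k, jb r k[ -> 0 <= nu k z.
  move=> zJ; apply: mulr_ge0; last by apply: ltW; exact: gamJ0 k z (Jsub k z zJ).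
  by have /andP[+ _] := bec k z zJ; exact: le_trans (ltW c30).
have e2ge0 (w : R -> R[i]) (W : R -> R) k : cmeasurable [set` J r k] w ->
    measurable_fun [set` J r k] W -> (forall z, z \in `]ja k, jb r k[ -> 0 <= W z) ->
    (0 <= \int[mu]_(z in [set` J r k]) (sqrc (w z) * W z)%:E)%E.
  exact: weighted_sqrc_integral_ge0.
(* The squared W^{1,2} error is the sum of two squared L^2 errors, each bounded with [Cm]; hence the
   2. *)
exists (Num.sqrt (2 * Cm)); first by rewrite sqrtr_gt0 mulr_gt0.
move=> N N0 kappa hkappa phi cphi err h.
have hk0 k : 0 < hk r N k by rewrite divr_gt0 ?subr_gt0 ?ltr0n//; exact: ab.
have hkt k : 0 <= hk r N k <= kappa * h by rewrite (ltW (hk0 k)) hkappa.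
have t0 : 0 <= kappa * h by have /andP[+ ] := hkt ord0; exact: le_trans.
have errE k : err k = fun z : R => cpwlin (ja k) ((jb r k - ja k) / (N k)%:R) (N k)
      (fun j => phi k (ja k + j%:R * ((jb r k - ja k) / (N k)%:R))) z - phi k z.
  by apply/funext => z; rewrite /err interp_cpwlin//; exact: ab.
have cerr k : ccontinuous_on (J r k) (err k).
  rewrite errE; apply: ccontinuousB => //; apply: ccontinuous_cpwlin; exact: hk0.
have L2 : in_W12 r sigma nu phi ->
    (L2norm2 r nu err <= (Cm * (kappa * h) ^+ 2)%:E * L2norm2 r sigma (gderiv r phi))%E.
  move=> [_ wphi [mg lg]].
  have e2g k : (0 <= \int[mu]_(z in [set` J r k]) (sqrc (gderiv r phi k z) * sigma k z)%:E)%E.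
    exact: e2ge0 (mg k) (msigma k) (sigma0 k).
  apply: (sum_edges_le CCm hkt) => // k.
  have [_ /(_ (N k) (phi k) (gderiv r phi k) (N0 k) (cphi k))[]] := HC k.
  - exact: wderivP.
  - exact: (sum_term_lty k e2g lg).
  - by rewrite errE => + _; exact.
have L2norm2_ge0 (w : 'I_(ge G).+1 -> R -> R[i]) (W : 'I_(ge G).+1 -> R -> R) :
    (forall k, cmeasurable [set` J r k] (w k)) -> (forall k, measurable_fun [set` J r k] (W k)) ->
    (forall k z, z \in `]ja k, jb r k[ -> 0 <= W k z) -> (0 <= L2norm2 r W w)%E.
  by move=> mw mW W0; apply: sume_ge0 => k _; exact: e2ge0 (mw k) (mW k) (W0 k).
have mphi k : cmeasurable [set` J r k] (phi k).
  exact: (@ccontinuous_cmeasurable _ (ja k) (jb r k) _ (cphi k)).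
have merr k : cmeasurable [set` J r k] (err k).
  exact: (@ccontinuous_cmeasurable _ (ja k) (jb r k) _ (cerr k)).
have Z0 : (0 <= L2norm2 r nu phi)%E by exact: L2norm2_ge0.
have X0 : in_W12 r sigma nu phi -> (0 <= L2norm2 r sigma (gderiv r phi))%E.
  by move=> [_ _ [mg _]]; exact: L2norm2_ge0.
have Ct0 : (0 <= (Cm * (kappa * h) ^+ 2)%:E :> \bar R)%E.
  by rewrite lee_fin mulr_ge0 ?sqr_ge0// ltW.
have scale2 (x y : \bar R) : (0 <= y)%E -> (x <= (2 * (Cm * (kappa * h) ^+ 2))%:E * y)%E ->
    (sqrte x <= (Num.sqrt (2 * Cm) * (kappa * h))%:E * sqrte y)%E.
  by rewrite mulrA => y0; apply: sqrte_scale_le => //; rewrite mulr_ge0// ltW.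
(* Gives the first estimate the same factor 2, so that one constant serves both. *)
have dbl (x y : \bar R) : (0 <= y)%E -> (x <= (Cm * (kappa * h) ^+ 2)%:E * y)%E ->
    (x <= (2 * (Cm * (kappa * h) ^+ 2))%:E * y)%E.
  move=> y0 /le_trans; apply; rewrite lee_wpmul2r// lee_fin ler_peMl ?ler1n//.
rewrite -mulrA; split=> [phiW|[[phiW _ _] wflux [mL lL] kir]].
  have X0' := X0 phiW.
  apply: scale2; first exact: adde_ge0.
  apply: dbl; first exact: adde_ge0.
  by apply: le_trans (L2 phiW) _; rewrite lee_wpmul2l// leeDr.
have X0' := X0 phiW; have L2' := L2 phiW.
have [[_ lphi] wphi [mg lg]] := phiW.
have e2g k : (0 <= \int[mu]_(z in [set` J r k]) (sqrc (gderiv r phi k z) * sigma k z)%:E)%E.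
  exact: e2ge0 (mg k) (msigma k) (sigma0 k).
have e2L k : (0 <= \int[mu]_(z in [set` J r k]) (sqrc (Lop r al be phi k z) * nu k z)%:E)%E.
  exact: e2ge0 (mL k) (mnu k) (nu0 k).
have Y0 : (0 <= L2norm2 r nu (Lop r al be phi))%E by exact: L2norm2_ge0.
have [gc [wgc cgc _]] := kir.
have wg k : weak_derivative (ja k) (jb r k) (phi k) (gderiv r phi k).
  exact: wderivP.
have werr k : exists g, weak_derivative (ja k) (jb r k) (err k) g.
  rewrite errE; eexists; apply: weak_derivativeB (wg k).
  by apply: weak_derivative_cpwlin; exact: hk0.
have wgerr k : weak_derivative (ja k) (jb r k) (err k) (gderiv r err k).
  exact: wderivP.
have mgerr k := weak_derivative_cmeasurable (wgerr k).
have H1 : (L2norm2 r sigma (gderiv r err) <= (Cm * (kappa * h) ^+ 2)%:E *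
    (L2norm2 r sigma (gderiv r phi) + L2norm2 r nu (Lop r al be phi)))%E.
  (* Joining the two sums edge by edge brings the right-hand side to the form of the edge
     estimate. *)
  rewrite /L2norm2 -big_split/=.
  apply: (sum_edges_le CCm hkt) => [k|k]; first exact: adde_ge0 (e2g k) (e2L k).
  have [_ /(_ (N k) (phi k) (gderiv r phi k) (N0 k) (cphi k) (wg k))[]] := HC k.
    exact: (sum_term_lty k e2g lg).
  move=> _ /(_ (gc k) (gderiv r (wmul al (gderiv r phi)) k) (gderiv r err k)
    (cgc k) (wgc k)); apply => //.
  - exact: wderivP.
  - exact: (sum_term_lty k e2L lL).
  - by rewrite -errE.
have EE0 : (0 <= L2norm2 r nu err)%E.
  exact: L2norm2_ge0.
split.
  split.
  - split; first exact: merr.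
    by apply: le_lt_trans L2' _; apply: lte_mul_pinfty.
  - exact: werr.
  - split; first exact: mgerr.
    by apply: le_lt_trans H1 _; apply: lte_mul_pinfty => //; exact: lte_add_pinfty.
set X := L2norm2 r sigma (gderiv r phi) in X0' L2' H1 *.
set Y := L2norm2 r nu (Lop r al be phi) in Y0 H1 *.
set Z := L2norm2 r nu phi in Z0 *.
(* The function error is controlled by [X], the derivative error by [X + Y], and both by
   [Z + X + Y]; subadditivity of the square root then separates the W^{1,2} norm from the norm of
   the operator term. *)
apply: (@le_trans _ _ ((Num.sqrt (2 * Cm) * (kappa * h))%:E * sqrte ((Z + X) + Y))%E).
  apply: scale2; first by rewrite !adde_ge0.
  rewrite mulr_natl mulr2n EFinD ge0_muleDl//.
  apply: leeD.
    apply: le_trans L2' _; rewrite lee_wpmul2l//.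
    by rewrite -addeA addeCA leeDl// adde_ge0.
  apply: le_trans H1 _; rewrite lee_wpmul2l//.
  by rewrite -addeA leeDr.
rewrite lee_wpmul2l//; first by rewrite lee_fin mulr_ge0// sqrtr_ge0.
by apply: sqrteD_le => //; exact: adde_ge0.
Qed.
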